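(* Let $K$ be a coaugmented differential graded coalgebra, $\Omega$ a differential graded algebra and $\phi:K^*\to\Omega^{*+1}$ a twisting cochain. (1) Let $\tilde\psi$ be the characteristic map of the twisting map on $K$ determined by $\phi$ (the map $\alpha\mapsto\sum\alpha^{(1)}\otimes\phi(\alpha^{(2)})$ up to signs), that is $$\tilde\psi(\alpha)=\sum_{n\ge0}[\phi(\alpha^{(1)})|\dots|\phi(\alpha^{(n)})]$$ (the $n=0$ term being $\epsilon(\alpha)[\,]$), where it is supposed that for each $\alpha\in K$ only finitely many terms are non-zero. Then $\tilde\psi:K\to B(\Omega)$ is a homomorphism of differential graded coalgebras. (2) Dually, the map $\tilde\varphi:F(K)\to\Omega$, $\tilde\varphi(\alpha_1\otimes\dots\otimes\alpha_n)=\phi(\alpha_1)\cdots\phi(\alpha_n)$, associated with $\varphi(\alpha\otimes\omega)=\phi(\alpha)\omega$, is a homomorphism of differential graded algebras.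
   Context: $\Bbbk$ is a field of characteristic $0$; differentials have degree $+1$. $k\mapsto k^{(1)}\otimes k^{(2)}$ is Sweedler notation for the coproduct and $k^{(1)}\otimes\dots\otimes k^{(n)}$ denotes the $(n-1)$-fold iterated coproduct; $\epsilon$ is the counit and $\eta:\Bbbk\to K$ the coaugmentation (a homomorphism of dg coalgebras). A twisting cochain is a linear map $\phi:K^*\to\Omega^{*+1}$ with $\phi\circ\eta=0$ and $$d_\Omega\phi-\phi d_K-\phi\ast\phi=0,\qquad (\phi\ast\phi)(k)=\sum(-1)^{|k^{(1)}|}\phi(k^{(1)})\phi(k^{(2)}).$$ $B(\Omega)=\bigoplus_{n\ge0}(\Omega[1])^{\otimes n}$, with elements $[a_1|\dots|a_n]$ of degree $\sum(|a_i|-1)$, has the deconcatenation coproduct, the projection to $n=0$ as counit, and differential $$D[a_1|\dots|a_n]=\sum_{i=1}^n(-1)^{\varepsilon_{i-1}}[a_1|\dots|da_i|\dots|a_n]+\sum_{i=1}^{n-1}(-1)^{\varepsilon_i+1}[a_1|\dots|a_ia_{i+1}|\dots|a_n],\quad \varepsilon_i=\sum_{j\le i}(|a_j|-1).$$ $F(K)=\bigoplus_{n\ge0}(K[-1])^{\otimes n}$ is the cobar construction: the tensor algebra on $K$ with $k\in K$ placed in degree $|k|+1$; its differential is the derivation determined on generators by $D[k]=[dk]+\sum(-1)^{|k^{(1)}|}[k^{(1)}|k^{(2)}]$. *)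

(* Defs.v *)
From HB Require Import structures.
From mathcomp Require Import all_boot all_order all_algebra.
From mathcomp Require Import boolp classical_sets functions cardinality fsbigop.
Set Implicit Arguments.
Unset Strict Implicit.
Unset Printing Implicit Defensive.
Import GRing.Theory.
Local Open Scope ring_scope.
Local Open Scope quotient_scope.

(* umod P is the k-module on generators X that is universal among the maps
   f : X -> U satisfying P: formal linear combinations of elements of X, where
   two of them are identified when every such f takes the same value on both.
   For P = bilinear_fun this is the tensor product of two modules, and for
   P = multilinear_fun (on words) it is the sum over n of the V^{(x) n}. *)
Section UniversalModule.
Variables (k : fieldType) (X : choiceType).
Variable P : forall U : lmodType k, (X -> U) -> Prop.

Definition umod_eval (U : lmodType k) (f : X -> U) (s : seq (k * X)) : U :=
  \sum_(p <- s) p.1 *: f p.2.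

Definition umod_rel (s t : seq (k * X)) : bool :=
  `[< forall (U : lmodType k) (f : X -> U), P f ->
        umod_eval f s = umod_eval f t >].

Lemma umod_rel_equiv : equiv_class_of umod_rel.
Proof.
split=> [s|s t|t s u].
- exact/asboolP.
- by apply/asboolP/asboolP => H U f Pf; rewrite H.
- by move=> /asboolP H1 /asboolP H2; apply/asboolP => U f Pf; rewrite H1 // H2.
Qed.

Canonical umod_equiv := EquivRelPack umod_rel_equiv.

Definition umod := {eq_quot umod_rel}.

HB.instance Definition _ := Choice.on umod.
HB.instance Definition _ := EqQuotient.on umod.

Lemma umod_piP (s t : seq (k * X)) :
  (forall (U : lmodType k) (f : X -> U), P f -> umod_eval f s = umod_eval f t)
  <-> \pi_umod s = \pi_umod t.
Proof. by split=> [H|/eqmodP/asboolP//]; apply/eqmodP/asboolP. Qed.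

Definition umod_lift (U : lmodType k) (f : X -> U) (q : umod) : U :=
  umod_eval f (repr q).

Lemma umod_lift_pi (U : lmodType k) (f : X -> U) (s : seq (k * X)) :
  P f -> umod_lift f (\pi_umod s) = umod_eval f s.
Proof. by move=> Pf; apply: (umod_piP _ _).2 => //; rewrite reprK. Qed.

Lemma umodP (x y : umod) :
  (forall (U : lmodType k) (f : X -> U), P f -> umod_lift f x = umod_lift f y)
  -> x = y.
Proof.
by move=> H; rewrite -[x]reprK -[y]reprK; apply/umod_piP => U f /H.
Qed.

Let scale_seq (a : k) (s : seq (k * X)) := [seq (a * p.1, p.2) | p <- s].

Let eval_cat (U : lmodType k) (f : X -> U) s t :
  umod_eval f (s ++ t) = umod_eval f s + umod_eval f t.
Proof. by rewrite /umod_eval big_cat. Qed.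

Let eval_scale (U : lmodType k) (f : X -> U) a s :
  umod_eval f (scale_seq a s) = a *: umod_eval f s.
Proof.
rewrite /umod_eval big_map scaler_sumr; apply: eq_bigr => p _ /=.
by rewrite scalerA.
Qed.

Definition umod_zero : umod := \pi_umod [::].
Definition umod_add (x y : umod) : umod := \pi_umod (repr x ++ repr y).
Definition umod_scale (a : k) (x : umod) : umod := \pi_umod (scale_seq a (repr x)).
Definition umod_opp (x : umod) : umod := umod_scale (-1) x.

Let lift0 (U : lmodType k) (f : X -> U) : P f -> umod_lift f umod_zero = 0.
Proof. by move=> Pf; rewrite umod_lift_pi // /umod_eval big_nil. Qed.
Let liftD (U : lmodType k) (f : X -> U) x y : P f ->
  umod_lift f (umod_add x y) = umod_lift f x + umod_lift f y.
Proof. by move=> Pf; rewrite umod_lift_pi // eval_cat. Qed.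
Let liftZ (U : lmodType k) (f : X -> U) a x : P f ->
  umod_lift f (umod_scale a x) = a *: umod_lift f x.
Proof. by move=> Pf; rewrite umod_lift_pi // eval_scale. Qed.

Lemma umod_addA : associative umod_add.
Proof. by move=> x y z; apply: umodP => U f Pf; rewrite !liftD // addrA. Qed.
Lemma umod_addC : commutative umod_add.
Proof. by move=> x y; apply: umodP => U f Pf; rewrite !liftD // addrC. Qed.
Lemma umod_add0 : left_id umod_zero umod_add.
Proof. by move=> x; apply: umodP => U f Pf; rewrite liftD // lift0 // add0r. Qed.
Lemma umod_addN : left_inverse umod_zero umod_opp umod_add.
Proof.
move=> x; apply: umodP => U f Pf.
by rewrite liftD // liftZ // lift0 // scaleN1r addNr.
Qed.
HB.instance Definition _ :=
  GRing.isZmodule.Build umod umod_addA umod_addC umod_add0 umod_addN.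

Lemma umod_scaleA a b x : umod_scale a (umod_scale b x) = umod_scale (a * b) x.
Proof. by apply: umodP => U f Pf; rewrite !liftZ // scalerA. Qed.
Lemma umod_scale1 : left_id 1 umod_scale.
Proof. by move=> x; apply: umodP => U f Pf; rewrite liftZ // scale1r. Qed.
Lemma umod_scaleDr : right_distributive umod_scale +%R.
Proof.
move=> a x y; apply: umodP => U f Pf.
by rewrite liftZ // !liftD // !liftZ // scalerDr.
Qed.
Lemma umod_scaleDl x : {morph umod_scale^~ x : a b / a + b}.
Proof.
by move=> a b; apply: umodP => U f Pf; rewrite liftD // !liftZ // scalerDl.
Qed.
HB.instance Definition _ := GRing.Zmodule_isLmodule.Build k umod
  umod_scaleA umod_scale1 umod_scaleDr umod_scaleDl.

Definition umod_gen (x : X) : umod := \pi_umod [:: (1, x)].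

Lemma umod_lift_gen (U : lmodType k) (f : X -> U) x :
  P f -> umod_lift f (umod_gen x) = f x.
Proof.
by move=> Pf; rewrite umod_lift_pi // /umod_eval big_seq1 scale1r.
Qed.

Lemma umod_lift_linear (U : lmodType k) (f : X -> U) :
  P f -> linear (umod_lift f).
Proof. by move=> Pf a x y; rewrite liftD // liftZ. Qed.

Lemma umod_genE (x : umod) : exists s : seq (k * X),
  x = \sum_(p <- s) p.1 *: umod_gen p.2.
Proof.
exists (repr x); apply: umodP => U f Pf; rewrite [LHS]/umod_lift.
elim: (repr x) => [|p s IH].
  by rewrite /umod_eval !big_nil lift0.
by rewrite /umod_eval !big_cons liftD // liftZ // umod_lift_gen // -IH.
Qed.

Lemma umod_linear_eq (U : lmodType k) (f g : umod -> U) :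
  linear f -> linear g -> (forall x, f (umod_gen x) = g (umod_gen x)) -> f =1 g.
Proof.
move=> lf lg fg x.
have add0 (h : umod -> U) : linear h -> h 0 = 0.
  by move=> lh; have := lh (-1) 0 0; rewrite scaler0 addr0 scaleN1r addNr.
have [s ->] := umod_genE x; elim: s => [|p s IH].
  by rewrite big_nil !add0.
by rewrite !big_cons lf lg fg IH.
Qed.

End UniversalModule.

Lemma linear_fun0 (k : fieldType) (U V : lmodType k) (f : U -> V) :
  linear f -> f 0 = 0.
Proof. by move=> lf; have := lf (-1) 0 0; rewrite scaler0 addr0 scaleN1r addNr. Qed.

Lemma linear_funD (k : fieldType) (U V : lmodType k) (f : U -> V) :
  linear f -> {morph f : x y / x + y}.
Proof. by move=> lf x y; rewrite -[x]scale1r lf !scale1r. Qed.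

Lemma linear_funZ (k : fieldType) (U V : lmodType k) (f : U -> V) :
  linear f -> forall a, {morph f : x / a *: x}.
Proof. by move=> lf a x; rewrite -[a *: x]addr0 lf (linear_fun0 lf) !addr0. Qed.

Lemma umod_ind (k : fieldType) (X : choiceType)
    (P : forall U : lmodType k, (X -> U) -> Prop) (Q : umod P -> Prop) :
  Q 0 -> (forall a x y, Q x -> Q y -> Q (a *: x + y)) ->
  (forall x, Q (umod_gen P x)) -> forall x, Q x.
Proof.
move=> Q0 QD Qg x; have [s ->] := umod_genE x.
elim: s => [|p s IH]; first by rewrite big_nil.
by rewrite big_cons; apply: QD.
Qed.

Lemma umod_lift_comb (k : fieldType) (X : choiceType)
    (P : forall U : lmodType k, (X -> U) -> Prop) (U : lmodType k)
    (f g h : X -> U) a (q : umod P) :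
  (forall x, h x = a *: f x + g x) ->
  umod_lift h q = a *: umod_lift f q + umod_lift g q.
Proof.
move=> H; rewrite /umod_lift /umod_eval scaler_sumr -big_split /=.
by apply: eq_bigr => p _; rewrite H scalerDr !scalerA mulrC.
Qed.

Section Tensor.
Variable k : fieldType.

Definition bilinear_fun (V W U : lmodType k) (f : V * W -> U) : Prop :=
  (forall w, linear (fun v => f (v, w))) /\ (forall v, linear (fun w => f (v, w))).

Definition tensor (V W : lmodType k) := umod (@bilinear_fun V W).
HB.instance Definition _ V W := GRing.Lmodule.on (tensor V W).

Definition pure (V W : lmodType k) (v : V) (w : W) : tensor V W :=
  umod_gen (@bilinear_fun V W) (v, w).

Lemma pure_linearl (V W : lmodType k) (w : W) : linear (fun v : V => pure v w).
Proof.
move=> a u v; apply: umodP => U f Pf; rewrite (umod_lift_linear Pf).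
by rewrite !umod_lift_gen //; exact: Pf.1.
Qed.

Lemma pure_linearr (V W : lmodType k) (v : V) : linear (fun w : W => pure v w).
Proof.
move=> a u w; apply: umodP => U f Pf; rewrite (umod_lift_linear Pf).
by rewrite !umod_lift_gen //; exact: Pf.2.
Qed.

Definition tensor_lift (V W U : lmodType k) (f : V -> W -> U) : tensor V W -> U :=
  umod_lift (fun p => f p.1 p.2).

Definition tensor_map (V W V' W' : lmodType k) (f : V -> V') (g : W -> W') :
    tensor V W -> tensor V' W' :=
  tensor_lift (fun v w => pure (f v) (g w)).

Definition tensor_assoc (U V W : lmodType k) :
    tensor (tensor U V) W -> tensor U (tensor V W) :=
  tensor_lift (fun t w => tensor_lift (fun u v => pure u (pure v w)) t).

(* f is linear in each letter of a word, with no relation between the values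
   on words of different lengths. *)
Definition multilinear_fun (V U : lmodType k) (f : seq V -> U) : Prop :=
  forall s t, linear (fun v => f (s ++ v :: t)).

Definition tensalg (V : lmodType k) := umod (@multilinear_fun V).
HB.instance Definition _ V := GRing.Lmodule.on (tensalg V).

(* word [:: v1; ...; vn] is the tensor [v1|...|vn], and word [::] is []. *)
Definition word (V : lmodType k) (s : seq V) : tensalg V :=
  umod_gen (@multilinear_fun V) s.

Lemma word_multilinear (V : lmodType k) : multilinear_fun (@word V).
Proof.
move=> s t a u v; apply: umodP => U f Pf; rewrite (umod_lift_linear Pf).
by rewrite !umod_lift_gen //; exact: Pf.
Qed.

Definition tensalg_lift (V U : lmodType k) (f : seq V -> U) : tensalg V -> U :=
  umod_lift f.

Definition tensalg_mul (V : lmodType k) (x y : tensalg V) : tensalg V :=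
  tensalg_lift (fun s => tensalg_lift (fun t => word (s ++ t)) y) x.

End Tensor.

Section TensorTheory.
Variable k : fieldType.
Implicit Types U V W : lmodType k.

Lemma bilinear_of V W U (f : V -> W -> U) :
  (forall w, linear (f^~ w)) -> (forall v, linear (f v)) ->
  bilinear_fun (fun p : V * W => f p.1 p.2).
Proof. by move=> fl fr; split=> [w|v] a x y /=; [apply: fl | apply: fr]. Qed.

Lemma tensor_liftE V W U (f : V -> W -> U) v w :
  (forall w, linear (f^~ w)) -> (forall v, linear (f v)) ->
  tensor_lift f (pure v w) = f v w.
Proof.
by move=> fl fr; rewrite /tensor_lift umod_lift_gen //; exact: bilinear_of.
Qed.

Lemma tensor_lift_linear V W U (f : V -> W -> U) :
  (forall w, linear (f^~ w)) -> (forall v, linear (f v)) ->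
  linear (tensor_lift f).
Proof. by move=> fl fr; apply: umod_lift_linear; exact: bilinear_of. Qed.

Lemma tensor_mapE V W V' W' (f : V -> V') (g : W -> W') v w :
  linear f -> linear g -> tensor_map f g (pure v w) = pure (f v) (g w).
Proof.
move=> lf lg; apply: tensor_liftE.
  by move=> y a u v'; rewrite lf pure_linearl.
by move=> x a u v'; rewrite lg pure_linearr.
Qed.

Lemma tensor_map_linear V W V' W' (f : V -> V') (g : W -> W') :
  linear f -> linear g -> linear (tensor_map f g).
Proof.
move=> lf lg; apply: tensor_lift_linear.
  by move=> y a u v'; rewrite lf pure_linearl.
by move=> x a u v'; rewrite lg pure_linearr.
Qed.

Lemma tensor_ind V W (Q : tensor V W -> Prop) :
  Q 0 -> (forall a x y, Q x -> Q y -> Q (a *: x + y)) ->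
  (forall v w, Q (pure v w)) -> forall x, Q x.
Proof. by move=> Q0 QD Qp; apply: umod_ind => // -[v w]; exact: Qp. Qed.

Lemma tensor_eq V W U (f g : tensor V W -> U) :
  linear f -> linear g -> (forall v w, f (pure v w) = g (pure v w)) -> f =1 g.
Proof. by move=> lf lg H; apply: umod_linear_eq => // -[]. Qed.

Lemma tensor_assoc_bilinear U V W :
  (forall w : W, linear (fun t : tensor U V =>
     tensor_lift (fun u v => pure u (pure v w)) t)) /\
  (forall t : tensor U V, linear (fun w : W =>
     tensor_lift (fun u v => pure u (pure v w)) t)).
Proof.
split=> [w|t].
  by apply: tensor_lift_linear => [v|u] a x y; rewrite ?pure_linearl ?pure_linearr.
by move=> a x y; apply: umod_lift_comb => p; rewrite !pure_linearr.
Qed.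

Lemma tensor_assocE U V W (u : U) (v : V) (w : W) :
  tensor_assoc (pure (pure u v) w) = pure u (pure v w).
Proof.
have [Hl Hr] := tensor_assoc_bilinear U V W.
rewrite /tensor_assoc tensor_liftE // tensor_liftE // => [v'|u'] a x y;
  by rewrite ?pure_linearl ?pure_linearr.
Qed.

Lemma tensor_assoc_linear U V W : linear (@tensor_assoc k U V W).
Proof.
by have [Hl Hr] := tensor_assoc_bilinear U V W; apply: tensor_lift_linear.
Qed.

Lemma tensalg_liftE V U (f : seq V -> U) s :
  multilinear_fun f -> tensalg_lift f (word s) = f s.
Proof. exact: umod_lift_gen. Qed.

Lemma tensalg_lift_linear V U (f : seq V -> U) :
  multilinear_fun f -> linear (tensalg_lift f).
Proof. exact: umod_lift_linear. Qed.

Lemma tensalg_ind V (Q : tensalg V -> Prop) :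
  Q 0 -> (forall a x y, Q x -> Q y -> Q (a *: x + y)) ->
  (forall s, Q (word s)) -> forall x, Q x.
Proof. exact: umod_ind. Qed.

Lemma tensalg_eq V U (f g : tensalg V -> U) :
  linear f -> linear g -> (forall s, f (word s) = g (word s)) -> f =1 g.
Proof. exact: umod_linear_eq. Qed.

Lemma tensalg_mul_multi V (s : seq V) :
  multilinear_fun (fun t => word (s ++ t)).
Proof. by move=> u v a x y; rewrite !catA word_multilinear. Qed.

Lemma tensalg_mul_linearr V (x : tensalg V) : linear (tensalg_mul x).
Proof.
move=> a y z; apply: umod_lift_comb => s.
exact: (tensalg_lift_linear (tensalg_mul_multi s)).
Qed.

Lemma tensalg_mul_multil V (y : tensalg V) :
  multilinear_fun (fun s => tensalg_lift (fun t => word (s ++ t)) y).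
Proof.
move=> u v a x z; apply: umod_lift_comb => t.
by rewrite -!catA /= word_multilinear.
Qed.

Lemma tensalg_mul_linearl V (y : tensalg V) :
  linear (fun x => tensalg_mul x y).
Proof. exact/tensalg_lift_linear/tensalg_mul_multil. Qed.

Lemma tensalg_mulE V (s t : seq V) :
  tensalg_mul (word s) (word t) = word (s ++ t).
Proof.
rewrite /tensalg_mul tensalg_liftE; last exact: tensalg_mul_multil.
by rewrite tensalg_liftE //; exact: tensalg_mul_multi.
Qed.

Lemma tensalg_mulA V : associative (@tensalg_mul k V).
Proof.
move=> x y z; elim/tensalg_ind: x => [|a x x' IH IH'|s].
- by rewrite !(linear_fun0 (tensalg_mul_linearl _)).
- by rewrite !tensalg_mul_linearl IH IH'.
elim/tensalg_ind: y => [|a y y' IH IH'|t].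
- rewrite (linear_fun0 (tensalg_mul_linearl _)).
  by rewrite !(linear_fun0 (tensalg_mul_linearr _)) (linear_fun0 (tensalg_mul_linearl _)).
- by rewrite tensalg_mul_linearl !tensalg_mul_linearr tensalg_mul_linearl IH IH'.
elim/tensalg_ind: z => [|a z z' IH IH'|u].
- by rewrite !(linear_fun0 (tensalg_mul_linearr _)).
- by rewrite !tensalg_mul_linearr IH IH'.
by rewrite !tensalg_mulE catA.
Qed.

Lemma tensalg_mul1x V : left_id (word [::]) (@tensalg_mul k V).
Proof.
apply: tensalg_eq => [||s]; last by rewrite tensalg_mulE.
  exact: tensalg_mul_linearr.
by move=> a x y.
Qed.

Lemma tensalg_mulx1 V : right_id (word [::]) (@tensalg_mul k V).
Proof.
apply: tensalg_eq => [||s]; last by rewrite tensalg_mulE cats0.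
  exact: tensalg_mul_linearl.
by move=> a x y.
Qed.

End TensorTheory.

(* A decomposition of V as the direct sum of the V_i, i : int, given by the
   projections V -> V_i; a graded module is V with such a decomposition. *)
Record grading (k : fieldType) (V : lmodType k) := Grading {
  hcomp :> int -> V -> V;
  hcomp_linear : forall i, linear (hcomp i);
  hcompK : forall i j x, hcomp i (hcomp j x) = if i == j then hcomp j x else 0;
  hcomp_finite : forall x, finite_set [set i | hcomp i x != 0]%classic;
  hcomp_sum : forall x, \sum_(i \in [set: int]%classic) hcomp i x = x }.

Definition homog (k : fieldType) (V : lmodType k) (g : grading V) (n : int) (x : V) :=
  g n x = x.

(* The Koszul sign x |-> (-1)^|x| x, extended linearly. *)
Definition gsign (k : fieldType) (V : lmodType k) (g : grading V) (x : V) : V :=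
  \sum_(i \in [set: int]%classic) (-1) ^ i *: g i x.

Section GradingTheory.
Variables (k : fieldType).
Implicit Types U V W : lmodType k.

Lemma fsum_seq V (F : int -> V) (r : seq int) : uniq r ->
  (forall i, i \notin r -> F i = 0) ->
  \sum_(i \in [set: int]%classic) F i = \sum_(i <- r) F i.
Proof.
move=> ur Fr; rewrite (fsbigE r) //; first by apply: eq_bigl => i; rewrite in_setT.
by move=> i _; exact: Fr.
Qed.

Variables (V : lmodType k) (g : grading V).

Lemma hcomp0 i : g i 0 = 0.
Proof. exact/linear_fun0/hcomp_linear. Qed.

Lemma gsupp_exists (x y : V) : exists r : seq int, [/\ uniq r,
  (forall i, i \notin r -> g i x = 0) & (forall i, i \notin r -> g i y = 0)].
Proof.
have [rx Hx] := (finite_seqP _).1 (hcomp_finite g x).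
have [ry Hy] := (finite_seqP _).1 (hcomp_finite g y).
have H z (rz : seq int) (Hz : [set i | g i z != 0]%classic = [set` rz]%classic) i :
    i \notin rz -> g i z = 0.
  move=> ni; apply/eqP; apply: contraNT ni => gz.
  have : [set i | g i z != 0]%classic i by [].
  by rewrite Hz.
exists (undup (rx ++ ry)); split; first exact: undup_uniq.
  by move=> i; rewrite mem_undup mem_cat negb_or => /andP[/(H _ _ Hx)].
by move=> i; rewrite mem_undup mem_cat negb_or => /andP[_ /(H _ _ Hy)].
Qed.

Lemma fsum_hcomp_linear U (F : int -> V -> U) : (forall i, linear (F i)) ->
  linear (fun x => \sum_(i \in [set: int]%classic) F i (g i x)).
Proof.
move=> lF a x y; have [r [ur rx ry]] := gsupp_exists x y.
rewrite !(fsum_seq ur); last 3 first.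
- by move=> i /ry ->; rewrite linear_fun0.
- by move=> i /rx ->; rewrite linear_fun0.
- by move=> i ni; rewrite hcomp_linear rx // ry // scaler0 addr0 linear_fun0.
rewrite scaler_sumr -big_split /=; apply: eq_bigr => i _.
by rewrite hcomp_linear lF.
Qed.

Lemma hcomp_homog n i x : homog g n x -> g i x = if i == n then x else 0.
Proof. by move=> hx; rewrite -{1}hx hcompK; case: eqP => // _; rewrite hx. Qed.

Lemma homog_hcomp n x : homog g n (g n x).
Proof. by rewrite /homog hcompK eqxx. Qed.

Lemma homog0 n : homog g n 0.
Proof. exact: hcomp0. Qed.

Lemma homogP n a x y : homog g n x -> homog g n y -> homog g n (a *: x + y).
Proof. by move=> hx hy; rewrite /homog hcomp_linear hx hy. Qed.

Lemma homogZ n a x : homog g n x -> homog g n (a *: x).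
Proof. by move=> hx; rewrite -[_ *: _]addr0; apply: homogP => //; exact: homog0. Qed.

Lemma homogD n x y : homog g n x -> homog g n y -> homog g n (x + y).
Proof. by move=> hx hy; rewrite -[x]scale1r; apply: homogP. Qed.

Lemma fsum_hcomp_homog U (F : int -> V -> U) n x : (forall i, linear (F i)) ->
  homog g n x -> \sum_(i \in [set: int]%classic) F i (g i x) = F n x.
Proof.
move=> lF hx; rewrite (@fsum_seq _ _ [:: n]) //.
  by rewrite big_seq1 hx.
move=> i; rewrite inE => ni; rewrite (hcomp_homog _ hx) (negPf ni).
exact: linear_fun0.
Qed.

Lemma gsign_linear : linear (gsign g).
Proof.
apply: (fsum_hcomp_linear (F := fun i x => (-1) ^ i *: x)) => i a x y.
by rewrite scalerDr !scalerA mulrC.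
Qed.

Lemma gsign_homog n x : homog g n x -> gsign g x = (-1) ^ n *: x.
Proof.
apply: (fsum_hcomp_homog (F := fun i x => (-1) ^ i *: x)) => i a y z.
by rewrite scalerDr !scalerA mulrC.
Qed.

Lemma homog_ind (Q : V -> Prop) :
  Q 0 -> (forall x y, Q x -> Q y -> Q (x + y)) ->
  (forall n x, homog g n x -> Q x) -> forall x, Q x.
Proof.
move=> Q0 QD Qh x; rewrite -(hcomp_sum g x).
have [r [ur rx _]] := gsupp_exists x x; rewrite (fsum_seq ur rx).
elim/big_ind: _ => // i _; exact: Qh (homog_hcomp i x).
Qed.

End GradingTheory.

(* gr_shift g m is the grading of V[m], with V[m]_n = V_(n + m). *)
Section Shift.
Variables (k : fieldType) (V : lmodType k) (g : grading V) (m : int).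

Definition gr_shift_hcomp (i : int) : V -> V := g (i + m).

Lemma gr_shift_finite x : finite_set [set i | gr_shift_hcomp i x != 0]%classic.
Proof.
have [r [_ rx _]] := gsupp_exists g x x.
apply: (@sub_finite_set _ _ [set` [seq i - m | i <- r]]%classic).
  move=> i /= gx; apply/mapP; exists (i + m); last by rewrite addrK.
  by case: (boolP (i + m \in r)) gx => // /rx; rewrite /gr_shift_hcomp => -> /eqP.
exact: finite_seq.
Qed.

Lemma gr_shift_sum x : \sum_(i \in [set: int]%classic) gr_shift_hcomp i x = x.
Proof.
have [r [ur rx _]] := gsupp_exists g x x.
transitivity (\sum_(i <- r) g i x); last by rewrite -(fsum_seq ur rx) hcomp_sum.
rewrite (@fsum_seq _ _ _ [seq i - m | i <- r]).
- by rewrite big_map; apply: eq_bigr => i _; rewrite /gr_shift_hcomp subrK.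
- by rewrite map_inj_uniq //; exact: addIr.
move=> i ni; apply: rx; apply: contraNN ni => ir.
by apply/mapP; exists (i + m); rewrite ?addrK.
Qed.

Lemma gr_shift_hcompK i j x :
  gr_shift_hcomp i (gr_shift_hcomp j x) = if i == j then gr_shift_hcomp j x else 0.
Proof. by rewrite /gr_shift_hcomp hcompK (inj_eq (addIr m)). Qed.

Definition gr_shift : grading V := @Grading _ _ gr_shift_hcomp
  (fun i => hcomp_linear g (i + m)) gr_shift_hcompK gr_shift_finite gr_shift_sum.

Lemma homog_shift n x : homog gr_shift n x = homog g (n + m) x.
Proof. by []. Qed.

End Shift.

Section TensorGrading.
Variable k : fieldType.

(* t lies in the sum over i of the V_i (x) W_(n - i). *)
Definition tensor_homog (V W : lmodType k) (gV : grading V) (gW : grading W)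
    (n : int) (t : tensor V W) : Prop :=
  exists s : seq (int * (V * W)),
    (forall p, p \in s -> homog gV p.1 p.2.1 /\ homog gW (n - p.1) p.2.2) /\
    t = \sum_(p <- s) pure p.2.1 p.2.2.

Lemma tensor_homog0 V W (gV : grading V) (gW : grading W) n :
  tensor_homog gV gW n 0.
Proof. by exists [::]; rewrite big_nil. Qed.

Lemma tensor_homogD V W (gV : grading V) (gW : grading W) n x y :
  tensor_homog gV gW n x -> tensor_homog gV gW n y -> tensor_homog gV gW n (x + y).
Proof.
move=> [s [Hs ->]] [t [Ht ->]]; exists (s ++ t); split; last by rewrite big_cat.
by move=> p; rewrite mem_cat => /orP[/Hs|/Ht].
Qed.

Lemma tensor_homogZ V W (gV : grading V) (gW : grading W) n a x :
  tensor_homog gV gW n x -> tensor_homog gV gW n (a *: x).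
Proof.
move=> [s [Hs ->]]; exists [seq (p.1, (a *: p.2.1, p.2.2)) | p <- s]; split.
  by move=> _ /mapP[p /Hs[h1 h2] ->]; split=> //=; exact: homogZ.
rewrite big_map scaler_sumr; apply: eq_bigr => p _ /=.
by rewrite (linear_funZ (pure_linearl _)).
Qed.

Lemma tensor_homog_pure V W (gV : grading V) (gW : grading W) n i j v w :
  homog gV i v -> homog gW j w -> n = i + j -> tensor_homog gV gW n (pure v w).
Proof.
move=> hv hw ->; exists [:: (i, (v, w))]; split; last by rewrite big_seq1.
by move=> p; rewrite inE => /eqP -> /=; rewrite addrC addKr.
Qed.

Section TensalgGrading.
Variables (V : lmodType k) (g : grading V).

(* The degree n component of [v1|...|vm] is the sum of the
   [(v1)_i1|...|(vm)_im] over i1 + ... + im = n. *)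
Fixpoint word_hcomp (s : seq V) (n : int) : tensalg V :=
  if s is v :: s' then
    \sum_(i \in [set: int]%classic)
      tensalg_mul (word [:: g i v]) (word_hcomp s' (n - i))
  else if n == 0 then word [::] else 0.

Definition tensalg_hcomp (n : int) : tensalg V -> tensalg V :=
  tensalg_lift (word_hcomp^~ n).

Lemma word1_linear : linear (fun v : V => word [:: v]).
Proof. exact: (word_multilinear [::] [::]). Qed.

Lemma word_hcomp_multi n : multilinear_fun (word_hcomp^~ n).
Proof.
move=> s t; elim: s n => [|v0 s IH] n a u v /=.
  apply: (fsum_hcomp_linear g (F := fun i v =>
    tensalg_mul (word [:: v]) (word_hcomp t (n - i)))) => i b x y.
  by rewrite word1_linear tensalg_mul_linearl.
have [r [ur rv _]] := gsupp_exists g v0 v0.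
have Z (w : tensalg V) i : i \notin r -> tensalg_mul (word [:: g i v0]) w = 0.
  move=> /rv ->; rewrite (linear_fun0 word1_linear).
  exact/linear_fun0/tensalg_mul_linearl.
rewrite !(fsum_seq ur); try by move=> i /Z ->.
rewrite scaler_sumr -big_split /=; apply: eq_bigr => i _.
by rewrite IH tensalg_mul_linearr.
Qed.

Lemma tensalg_hcomp_linear n : linear (tensalg_hcomp n).
Proof. exact/tensalg_lift_linear/word_hcomp_multi. Qed.

Inductive homog_word : int -> seq V -> Prop :=
| homog_word_nil : homog_word 0 [::]
| homog_word_cons i n v s :
    homog g i v -> homog_word n s -> homog_word (i + n) (v :: s).

Lemma homog_word_cat m n s t :
  homog_word m s -> homog_word n t -> homog_word (m + n) (s ++ t).
Proof.
move=> hs ht; elim: hs => [|i p v u hv _ IH]; first by rewrite add0r.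
by rewrite -addrA; constructor.
Qed.

Lemma word_hcompE m n s : homog_word n s ->
  word_hcomp s m = if m == n then word s else 0.
Proof.
move=> hs; elim: hs m => [//|i p v u hv _ IH] m /=.
rewrite (fsum_hcomp_homog (F := fun i v =>
    tensalg_mul (word [:: v]) (word_hcomp u (m - i))) _ hv); last first.
  by move=> j b x y; rewrite word1_linear tensalg_mul_linearl.
rewrite IH subr_eq [p + i]addrC; case: eqP => _; first by rewrite tensalg_mulE.
exact/linear_fun0/tensalg_mul_linearr.
Qed.

Lemma tensalg_hcompE m n s : homog_word n s ->
  tensalg_hcomp m (word s) = if m == n then word s else 0.
Proof.
by move=> hs; rewrite /tensalg_hcomp tensalg_liftE ?(word_hcompE _ hs) //;
   exact: word_hcomp_multi.
Qed.

Lemma tensalg_homog_ind (Q : tensalg V -> Prop) :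
  Q 0 -> (forall a x y, Q x -> Q y -> Q (a *: x + y)) ->
  (forall n s, homog_word n s -> Q (word s)) -> forall x, Q x.
Proof.
move=> Q0 QD Qh; apply: tensalg_ind => // t.
suff H s n : homog_word n s -> Q (word (s ++ t)) by apply: (H [::] 0); constructor.
elim: t s n => [|v t IH] s n hs; first by rewrite cats0; apply: Qh hs.
pattern v; apply: (homog_ind (g := g)) => [|x y Qx Qy|m x hx].
- by rewrite (linear_fun0 (word_multilinear s t)).
- rewrite (linear_funD (word_multilinear s t)).
  by rewrite -[word _]scale1r; apply: QD.
- rewrite -cat_rcons; apply: (IH _ (n + m)); rewrite -cats1.
  apply: homog_word_cat hs _; rewrite -[m]addr0.
  by constructor=> //; constructor.
Qed.

Lemma tensalg_hcompK i j x :
  tensalg_hcomp i (tensalg_hcomp j x) = if i == j then tensalg_hcomp j x else 0.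
Proof.
elim/tensalg_homog_ind: x => [|a x y Hx Hy|n s hs].
- rewrite (linear_fun0 (tensalg_hcomp_linear j)).
  by rewrite (linear_fun0 (tensalg_hcomp_linear i)); case: ifP.
- rewrite !tensalg_hcomp_linear Hx Hy; case: ifP => // _.
  by rewrite scaler0 addr0.
rewrite (tensalg_hcompE j hs); case: (eqVneq j n) => [->|nj].
  by rewrite (tensalg_hcompE i hs).
by rewrite (linear_fun0 (tensalg_hcomp_linear i)); case: ifP.
Qed.

Lemma tensalg_supp x : exists2 r : seq int, uniq r &
  (forall i, i \notin r -> tensalg_hcomp i x = 0) /\
  x = \sum_(i <- r) tensalg_hcomp i x.
Proof.
have ext (r r' : seq int) y : uniq r -> uniq r' -> {subset r <= r'} ->
    (forall i, i \notin r -> tensalg_hcomp i y = 0) ->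
    \sum_(i <- r) tensalg_hcomp i y = \sum_(i <- r') tensalg_hcomp i y.
  move=> ur ur' rr' r0; rewrite -(fsum_seq ur r0) -(fsum_seq ur') //.
  by move=> i ni; apply: r0; apply: contraNN ni => /rr'.
elim/tensalg_homog_ind: x => [|a x y [r ur [r0 rE]] [t ut [t0 tE]]|n s hs].
- exists [::] => //; split; last by rewrite big_nil.
  by move=> i _; exact/linear_fun0/tensalg_hcomp_linear.
- have uu := undup_uniq (r ++ t).
  exists (undup (r ++ t)) => //; split.
    move=> i; rewrite mem_undup mem_cat negb_or => /andP[/r0 Hx /t0 Hy].
    by rewrite tensalg_hcomp_linear Hx Hy scaler0 addr0.
  rewrite {1}rE {1}tE (ext _ _ x ur uu) //; last first.
    by move=> i; rewrite mem_undup mem_cat => ->.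
  rewrite (ext _ _ y ut uu) //; last first.
    by move=> i; rewrite mem_undup mem_cat orbC => ->.
  rewrite scaler_sumr -big_split; apply: eq_bigr => i _ /=.
  by rewrite tensalg_hcomp_linear.
- exists [:: n] => //; split; last first.
    by rewrite big_seq1 (tensalg_hcompE _ hs) eqxx.
  by move=> i; rewrite inE (tensalg_hcompE _ hs) => /negPf ->.
Qed.

Lemma tensalg_finite x : finite_set [set i | tensalg_hcomp i x != 0]%classic.
Proof.
have [r ur [r0 _]] := tensalg_supp x.
apply: (@sub_finite_set _ _ [set` r]%classic); last exact: finite_seq.
by move=> i /= hx; case: (boolP (i \in r)) hx => // /r0 -> /eqP.
Qed.

Lemma tensalg_sum x : \sum_(i \in [set: int]%classic) tensalg_hcomp i x = x.
Proof.
by have [r ur [r0 rE]] := tensalg_supp x; rewrite (fsum_seq ur r0) -rE.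
Qed.

Definition tensalg_grading : grading (tensalg V) :=
  Grading tensalg_hcomp_linear tensalg_hcompK tensalg_finite tensalg_sum.

Lemma homog_tensalg_word n s : homog_word n s -> homog tensalg_grading n (word s).
Proof. by move=> hs; rewrite /homog /= (tensalg_hcompE _ hs) eqxx. Qed.

End TensalgGrading.
End TensorGrading.

Section SignTheory.
Variable k : fieldType.
Implicit Types U V W : lmodType k.

Lemma linear_comp U V W (f : V -> W) (h : U -> V) :
  linear f -> linear h -> linear (fun x => f (h x)).
Proof. by move=> lf lh a x y; rewrite lh lf. Qed.

Lemma linear_add U V (f h : U -> V) :
  linear f -> linear h -> linear (fun x => f x + h x).
Proof. by move=> lf lh a x y; rewrite lf lh scalerDr addrACA. Qed.

Lemma linear_opp U V (f : U -> V) : linear f -> linear (fun x => - f x).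
Proof. by move=> lf a x y; rewrite lf opprD scalerN. Qed.

Lemma linear_id U : linear (fun x : U => x).
Proof. by []. Qed.

Lemma linear_zero U V : linear (fun x : U => 0 : V).
Proof. by move=> a x y; rewrite scaler0 addr0. Qed.

Lemma linear_scaleC U V (f : U -> V) a : linear f -> linear (fun x => a *: f x).
Proof. by move=> lf b x y; rewrite lf scalerDr !scalerA mulrC. Qed.

Lemma linear_funN U V (f : U -> V) : linear f -> {morph f : x / - x}.
Proof. by move=> lf x; rewrite -scaleN1r (linear_funZ lf) scaleN1r. Qed.

Lemma linear_funB U V (f : U -> V) : linear f -> {morph f : x y / x - y}.
Proof. by move=> lf x y; rewrite (linear_funD lf) (linear_funN lf). Qed.

Lemma linear_fun_sum U V (f : U -> V) (I : Type) (r : seq I) (P : pred I) F :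
  linear f -> f (\sum_(i <- r | P i) F i) = \sum_(i <- r | P i) f (F i).
Proof.
by move=> lf; apply: (big_morph f (linear_funD lf)); exact: linear_fun0.
Qed.

Lemma homog_eq V U (g : grading V) (f h : V -> U) : linear f -> linear h ->
  (forall n x, homog g n x -> f x = h x) -> f =1 h.
Proof.
move=> lf lh H; apply: (homog_ind (g := g)) => [|x y fx fy|n x /H//].
  by rewrite !linear_fun0.
by rewrite !linear_funD // fx fy.
Qed.

Lemma sign_sqr (n : int) : (-1 : k) ^ n * (-1) ^ n = 1.
Proof. by rewrite -expfzMl mulrNN mulr1 exp1rz. Qed.

Lemma signD (m n : int) : (-1 : k) ^ (m + n) = (-1) ^ m * (-1) ^ n.
Proof. by apply: expfzDr; rewrite oppr_eq0 oner_eq0. Qed.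

Lemma signS (n : int) : (-1 : k) ^ (n + 1) = - (-1) ^ n.
Proof. by rewrite signD expr1z mulrN1. Qed.

Lemma signP (n : int) : (-1 : k) ^ (n - 1) = - (-1) ^ n.
Proof. by rewrite -[in RHS](subrK 1 n) signS opprK. Qed.

Lemma gsignK V (g : grading V) : involutive (gsign g).
Proof.
apply: (homog_eq (g := g)) => [|//|n x hx].
  exact: linear_comp (gsign_linear g) (gsign_linear g).
rewrite (gsign_homog hx) (linear_funZ (gsign_linear g)) (gsign_homog hx).
by rewrite scalerA sign_sqr scale1r.
Qed.

Lemma gsign_deg1 V W (g : grading V) (g' : grading W) (f : V -> W) : linear f ->
  (forall n x, homog g n x -> homog g' (n + 1) (f x)) ->
  forall x, gsign g' (f x) = - f (gsign g x).
Proof.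
move=> lf df; apply: (homog_eq (g := g)) => [||n x hx].
- exact: linear_comp (gsign_linear _) lf.
- exact/linear_opp/linear_comp/gsign_linear.
rewrite (gsign_homog (df _ _ hx)) (gsign_homog hx) (linear_funZ lf) signS.
by rewrite scaleNr.
Qed.

Lemma gsign_shift1 V (g : grading V) x : gsign (gr_shift g 1) x = - gsign g x.
Proof.
move: x; apply: (homog_eq (g := g)) => [||n x hx].
- exact: gsign_linear.
- exact/linear_opp/gsign_linear.
have hx1 : homog (gr_shift g 1) (n - 1) x by rewrite homog_shift subrK.
by rewrite (gsign_homog hx1) (gsign_homog hx) signP scaleNr.
Qed.

Lemma gsign_shiftN1 V (g : grading V) x : gsign (gr_shift g (-1)) x = - gsign g x.
Proof.
move: x; apply: (homog_eq (g := g)) => [||n x hx].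
- exact: gsign_linear.
- exact/linear_opp/gsign_linear.
have hx1 : homog (gr_shift g (-1)) (n + 1) x by rewrite homog_shift addrK.
by rewrite (gsign_homog hx1) (gsign_homog hx) signS scaleNr.
Qed.

Lemma homog_gsign V (g : grading V) n x : homog g n x -> homog g n (gsign g x).
Proof. by move=> hx; rewrite (gsign_homog hx); exact: homogZ. Qed.

Lemma gsign_tensor V W (g : grading V) (g' : grading W) n (t : tensor V W) :
  tensor_homog g g' n t ->
  tensor_map (gsign g) (gsign g') t = (-1) ^ n *: t.
Proof.
have lm := tensor_map_linear (gsign_linear g) (gsign_linear g').
move=> [s [Hs ->]]; rewrite (linear_fun_sum _ _ _ lm) scaler_sumr.
rewrite !big_seq; apply: eq_bigr => p /Hs[h1 h2].
rewrite tensor_mapE; try exact: gsign_linear.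
rewrite (gsign_homog h1) (gsign_homog h2).
rewrite (linear_funZ (pure_linearl _)) (linear_funZ (pure_linearr _)) scalerA.
by rewrite -signD addrC subrK.
Qed.

Section SignWords.
Variables (V : lmodType k) (g : grading V).

Lemma map_multi U (f : U -> V) : linear f ->
  multilinear_fun (fun s => word (map f s)).
Proof. by move=> lf s t a x y; rewrite !map_cat /= lf word_multilinear. Qed.

Lemma gsign_word s : gsign (tensalg_grading g) (word s) = word (map (gsign g) s).
Proof.
have ml := map_multi (gsign_linear g).
rewrite -(tensalg_liftE s ml); move: (word s); apply: (tensalg_homog_ind (g := g)).
- rewrite (linear_fun0 (tensalg_lift_linear ml)).
  exact: linear_fun0 (gsign_linear _).
- by move=> a x y Hx Hy; rewrite gsign_linear (tensalg_lift_linear ml) Hx Hy.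
move=> n t ht; rewrite (gsign_homog (homog_tensalg_word ht)) (tensalg_liftE _ ml).
elim: ht => [|i m v u hv hu IH] /=; first by rewrite expr0z scale1r.
rewrite (gsign_homog hv) signD -scalerA.
have lc := word_multilinear [::] (map (gsign g) u).
rewrite (linear_funZ lc) /=; congr (_ *: _).
rewrite -[v :: map _ u]cat1s -[v :: u]cat1s -!tensalg_mulE -IH.
by rewrite (linear_funZ (tensalg_mul_linearr _)).
Qed.

Lemma tensalg_map_deg U (f : tensalg V -> U) (Q : int -> U -> Prop) (p : int) :
  linear f -> (forall n, Q n 0) ->
  (forall n a x y, Q n x -> Q n y -> Q n (a *: x + y)) ->
  (forall n s, homog_word g n s -> Q (n + p) (f (word s))) ->
  forall n x, homog (tensalg_grading g) n x -> Q (n + p) (f x).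
Proof.
move=> lf Q0 QD H n x <-; elim/(tensalg_homog_ind (g := g)): x => [|a x y Hx Hy|m s hs].
- by rewrite hcomp0 (linear_fun0 lf).
- by rewrite hcomp_linear lf; apply: QD.
rewrite /= (tensalg_hcompE _ hs); case: eqP => [->|_]; first exact: H.
by rewrite (linear_fun0 lf).
Qed.

Lemma tensalg_mul_deg m n x y :
  homog (tensalg_grading g) m x -> homog (tensalg_grading g) n y ->
  homog (tensalg_grading g) (m + n) (tensalg_mul x y).
Proof.
move=> hx; rewrite addrC.
apply: (tensalg_map_deg (Q := homog (tensalg_grading g))) n y; first exact: tensalg_mul_linearr.
- exact: homog0.
- by move=> n a y z; apply: homogP.
move=> n t ht; rewrite addrC; apply: (tensalg_map_deg (f := fun z => tensalg_mul z (word t))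
  (Q := homog (tensalg_grading g))) m x hx.
- exact: tensalg_mul_linearl.
- exact: homog0.
- by move=> m a y z; apply: homogP.
move=> m s hs; rewrite tensalg_mulE; apply: homog_tensalg_word.
exact: homog_word_cat.
Qed.

Lemma homog_word1 n v : homog g n v -> homog (tensalg_grading g) n (word [:: v]).
Proof.
move=> hv; apply: homog_tensalg_word; rewrite -[n]addr0.
by constructor=> //; constructor.
Qed.

End SignWords.
End SignTheory.

(* In dgc_d_comul the term d (x) 1 carries no sign, and (1 (x) d) (u (x) v) is
   (-1)^|u| u (x) d v. *)
Record dgCoalgebra (k : fieldType) := DGCoalgebra {
  dgc_car :> lmodType k;
  dgc_gr : grading dgc_car;
  dgc_d : dgc_car -> dgc_car;
  dgc_comul : dgc_car -> tensor dgc_car dgc_car;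
  dgc_counit : dgc_car -> k^o;
  dgc_d_linear : linear dgc_d;
  dgc_comul_linear : linear dgc_comul;
  dgc_counit_linear : linear dgc_counit;
  dgc_d_deg : forall n x, homog dgc_gr n x -> homog dgc_gr (n + 1) (dgc_d x);
  dgc_comul_deg : forall n x, homog dgc_gr n x ->
    tensor_homog dgc_gr dgc_gr n (dgc_comul x);
  dgc_counit_deg : forall n x, homog dgc_gr n x -> n != 0 -> dgc_counit x = 0;
  dgc_dd : forall x, dgc_d (dgc_d x) = 0;
  dgc_coassoc : forall x,
    tensor_assoc (tensor_map dgc_comul id (dgc_comul x)) =
    tensor_map id dgc_comul (dgc_comul x);
  dgc_counitl : forall x,
    tensor_lift (fun u v => (dgc_counit u : k) *: v) (dgc_comul x) = x;
  dgc_counitr : forall x,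
    tensor_lift (fun u v => (dgc_counit v : k) *: u) (dgc_comul x) = x;
  dgc_d_comul : forall x, dgc_comul (dgc_d x) =
    tensor_map dgc_d id (dgc_comul x) +
    tensor_map (gsign dgc_gr) dgc_d (dgc_comul x);
  dgc_d_counit : forall x, dgc_counit (dgc_d x) = 0 }.

Record is_dgc_hom (k : fieldType) (C D : dgCoalgebra k) (f : C -> D) : Prop :=
  IsDGCHom {
  dgc_hom_linear : linear f;
  dgc_hom_deg : forall n x, homog (dgc_gr C) n x -> homog (dgc_gr D) n (f x);
  dgc_hom_d : forall x, f (dgc_d x) = dgc_d (f x);
  dgc_hom_comul : forall x, dgc_comul (f x) = tensor_map f f (dgc_comul x);
  dgc_hom_counit : forall x, dgc_counit (f x) = dgc_counit x }.

(* Algebras are associative and unital, and may be zero; the latter is why they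
   are not built on algType. *)
Record dgAlgebra (k : fieldType) := DGAlgebra {
  dga_car :> lmodType k;
  dga_gr : grading dga_car;
  dga_d : dga_car -> dga_car;
  dga_mul : dga_car -> dga_car -> dga_car;
  dga_one : dga_car;
  dga_d_linear : linear dga_d;
  dga_mul_linearl : forall y, linear (dga_mul^~ y);
  dga_mul_linearr : forall x, linear (dga_mul x);
  dga_d_deg : forall n x, homog dga_gr n x -> homog dga_gr (n + 1) (dga_d x);
  dga_mul_deg : forall m n x y, homog dga_gr m x -> homog dga_gr n y ->
    homog dga_gr (m + n) (dga_mul x y);
  dga_one_deg : homog dga_gr 0 dga_one;
  dga_dd : forall x, dga_d (dga_d x) = 0;
  dga_mulA : associative dga_mul;
  dga_mul1x : left_id dga_one dga_mul;
  dga_mulx1 : right_id dga_one dga_mul;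
  dga_leibniz : forall n x y, homog dga_gr n x ->
    dga_d (dga_mul x y) =
    dga_mul (dga_d x) y + (-1) ^ n *: dga_mul x (dga_d y) }.

Record is_dga_hom (k : fieldType) (A B : dgAlgebra k) (f : A -> B) : Prop :=
  IsDGAHom {
  dga_hom_linear : linear f;
  dga_hom_deg : forall n x, homog (dga_gr A) n x -> homog (dga_gr B) n (f x);
  dga_hom_d : forall x, f (dga_d x) = dga_d (f x);
  dga_hom_mul : forall x y, f (dga_mul x y) = dga_mul (f x) (f y);
  dga_hom_one : f (dga_one A) = dga_one B }.

Section GroundField.
Variable k : fieldType.

Definition ground_hcomp (i : int) (x : k^o) : k^o := if i == 0 then x else 0.

Lemma ground_hcomp_linear i : linear (ground_hcomp i).
Proof. by move=> a x y; rewrite /ground_hcomp; case: ifP; rewrite ?scaler0 ?addr0. Qed.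

Lemma ground_hcompK i j x :
  ground_hcomp i (ground_hcomp j x) = if i == j then ground_hcomp j x else 0.
Proof.
by rewrite /ground_hcomp; have [->|_] := eqVneq j 0; rewrite ?if_same.
Qed.

Lemma ground_finite x : finite_set [set i | ground_hcomp i x != 0]%classic.
Proof.
apply: (@sub_finite_set _ _ [set` [:: 0 : int]]%classic); last exact: finite_seq.
by move=> i /=; rewrite /ground_hcomp inE; case: (i == 0) => //; rewrite eqxx.
Qed.

Lemma ground_sum x : \sum_(i \in [set: int]%classic) ground_hcomp i x = x.
Proof.
rewrite (@fsum_seq _ _ _ [:: 0]) ?big_seq1 // => i.
by rewrite inE /ground_hcomp => /negPf ->.
Qed.

Definition ground_grading : grading k^o :=
  Grading ground_hcomp_linear ground_hcompK ground_finite ground_sum.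

Definition ground_comul (x : k^o) : tensor k^o k^o := pure x (1 : k^o).

Lemma ground_comul_linear : linear ground_comul.
Proof. exact: pure_linearl. Qed.

Lemma ground_comul_deg n x : homog ground_grading n x ->
  tensor_homog ground_grading ground_grading n (ground_comul x).
Proof.
by move=> hx; apply: (@tensor_homog_pure _ _ _ _ _ _ n 0) => //; rewrite addr0.
Qed.

Definition ground_dgCoalgebra : dgCoalgebra k.
Proof.
refine (@DGCoalgebra k k^o ground_grading (fun=> 0) ground_comul id
  _ ground_comul_linear _ _ ground_comul_deg _ _ _ _ _ _ _) => //.
- exact: linear_zero.
- by move=> n x _; exact: homog0.
- by move=> n x <- /negPf n0; rewrite /= /ground_hcomp n0.
- move=> x; rewrite /ground_comul !tensor_mapE ?tensor_assocE //;
    exact: ground_comul_linear.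
- by move=> x; rewrite /ground_comul tensor_liftE /= ?[_ *: _]mulr1 // => y a u v;
   rewrite ?scalerDl ?scalerDr ?scalerA //= mulrC.
- move=> x; rewrite /ground_comul tensor_liftE /= ?scale1r // => y a u v.
    by rewrite scalerDr !scalerA mulrC.
  by rewrite scalerDl scalerA.
- move=> x; rewrite (linear_fun0 ground_comul_linear) /ground_comul.
  rewrite !tensor_mapE ?(linear_fun0 (pure_linearl _)) ?(linear_fun0 (pure_linearr _)).
  + by rewrite addr0.
  + exact: gsign_linear.
  + exact: linear_zero.
  + exact: linear_zero.
  + by [].
Defined.
End GroundField.

Record coaugDGCoalgebra (k : fieldType) := CoaugDGCoalgebra {
  coaug_dgc :> dgCoalgebra k;
  coaug : ground_dgCoalgebra k -> coaug_dgc;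
  coaug_hom : is_dgc_hom coaug }.

Section Bar.
Variables (k : fieldType) (Omega : dgAlgebra k).
Local Notation gB := (gr_shift (dga_gr Omega) 1).
Local Notation sg := (gsign gB).
Local Notation "x ** y" := (@dga_mul k Omega x y) (at level 40).

(* sg is the sign operator of Omega[1], so that [sg a_1|...|sg a_i] is
   (-1)^(eps_i) [a_1|...|a_i] for homogeneous a_j, eps_i being the sum of the
   |a_j| - 1 for j <= i. *)
Definition bar_grading : grading (tensalg Omega) := tensalg_grading gB.

Definition bar_d_word (s : seq Omega) : tensalg Omega :=
  \sum_(i < size s)
     word (map sg (take i s) ++ dga_d s`_i :: drop i.+1 s)
  - \sum_(i < (size s).-1)
     word (map sg (take i s) ++ (sg s`_i ** s`_i.+1) :: drop i.+2 s).

Definition bar_d : tensalg Omega -> tensalg Omega := tensalg_lift bar_d_word.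

Definition deconcat_word (s : seq Omega) : tensor (tensalg Omega) (tensalg Omega) :=
  \sum_(i < (size s).+1) pure (word (take i s)) (word (drop i s)).

Definition deconcat : tensalg Omega -> tensor (tensalg Omega) (tensalg Omega) :=
  tensalg_lift deconcat_word.

Definition bar_counit : tensalg Omega -> k^o :=
  tensalg_lift (fun s => (size s == 0)%:R : k^o).

Local Notation T := (tensalg Omega).
Local Notation mul_l := (@dga_mul_linearl k Omega _).
Local Notation mul_r := (@dga_mul_linearr k Omega _).
Local Notation tmul_l := (tensalg_mul_linearl _).
Local Notation tmul_r := (tensalg_mul_linearr _).

Let word_cons (v : Omega) s : tensalg_mul (word [:: v]) (word s) = word (v :: s).
Proof. exact: tensalg_mulE. Qed.

Let cons_linear (x : T) : linear (fun v : Omega => tensalg_mul (word [:: v]) x).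
Proof. by move=> a u v; rewrite word1_linear tensalg_mul_linearl. Qed.

Let merge_word (v : Omega) (s : seq Omega) : T :=
  if s is u :: t then word (sg v ** u :: t) else 0.

Let merge_multi v : multilinear_fun (merge_word v).
Proof.
move=> [|u s] t a x y /=.
  have lc := word_multilinear [::] t; rewrite -lc /=.
  by rewrite dga_mul_linearr.
exact: (word_multilinear (sg v ** u :: s) t).
Qed.

Let merge_word_linear s : linear (fun v => merge_word v s).
Proof.
case: s => [|u t] a x y /=; first by rewrite scaler0 addr0.
have lc := word_multilinear [::] t; rewrite -lc /=.
by rewrite gsign_linear dga_mul_linearl.
Qed.

Let merge v : T -> T := tensalg_lift (merge_word v).
Let merge_linear v : linear (merge v).
Proof. exact: tensalg_lift_linear. Qed.
Let mergeE v s : merge v (word s) = merge_word v s.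
Proof. exact: tensalg_liftE. Qed.

Let bar_d_word_cons v s : bar_d_word (v :: s) =
  word (dga_d v :: s) + tensalg_mul (word [:: sg v]) (bar_d_word s) - merge_word v s.
Proof.
rewrite {1}/bar_d_word big_ord_recl /= drop0 -!addrA; congr (_ + _).
rewrite (linear_funB tmul_r) !(linear_fun_sum _ _ _ tmul_r).
rewrite -addrA; congr (_ + _).
  by apply: eq_bigr => i _; rewrite word_cons.
case: s => [|u s] /=; first by rewrite !big_ord0 ?oppr0 ?addr0 ?subr0.
rewrite big_ord_recl /= drop0 opprD addrC; congr (- _ - _).
by apply: eq_bigr => i _; rewrite word_cons.
Qed.

Let comb4 (A : lmodType k) (a : k) (x x' y y' z z' : A) :
  a *: x + x' + (a *: y + y') - (a *: z + z') = a *: (x + y - z) + (x' + y' - z').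
Proof.
rewrite !scalerDr scalerN opprD; rewrite [_ + x' + _]addrACA -!addrA.
congr (_ + (_ + _)); rewrite [RHS]addrCA; congr (_ + _).
by rewrite [RHS]addrCA.
Qed.

Lemma bar_d_word_multi : multilinear_fun bar_d_word.
Proof.
move=> s t; elim: s => [|v0 s IH] a u v /=; rewrite !bar_d_word_cons.
  have lc := word_multilinear [::] t; rewrite dga_d_linear lc gsign_linear.
  by rewrite cons_linear merge_word_linear comb4.
have lc := word_multilinear (dga_d v0 :: s) t; rewrite lc IH tensalg_mul_linearr.
by rewrite merge_multi comb4.
Qed.

Lemma bar_d_linear : linear bar_d.
Proof. exact/tensalg_lift_linear/bar_d_word_multi. Qed.

Lemma bar_dE s : bar_d (word s) = bar_d_word s.
Proof. exact/tensalg_liftE/bar_d_word_multi. Qed.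

Let bar_d_nil : bar_d (word [::]) = 0.
Proof. by rewrite bar_dE /bar_d_word !big_ord0 subrr. Qed.

Let bar_d_cons v x : bar_d (tensalg_mul (word [:: v]) x) =
  tensalg_mul (word [:: dga_d v]) x + tensalg_mul (word [:: sg v]) (bar_d x)
  - merge v x.
Proof.
move: x; apply: tensalg_eq => [||s].
- exact: linear_comp bar_d_linear tmul_r.
- apply: linear_add; last exact: linear_opp.
  apply: linear_add; first exact: tmul_r.
  exact: linear_comp tmul_r bar_d_linear.
by rewrite !word_cons !bar_dE bar_d_word_cons mergeE.
Qed.

Let bar_d_cons1 v s : bar_d (word (v :: s)) = word (dga_d v :: s) +
  tensalg_mul (word [:: sg v]) (bar_d (word s)) - merge_word v s.
Proof. by rewrite -word_cons bar_d_cons word_cons mergeE. Qed.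

Let merge_cons v u x :
  merge v (tensalg_mul (word [:: u]) x) = tensalg_mul (word [:: sg v ** u]) x.
Proof.
move: x; apply: tensalg_eq => [||s]; [exact: linear_comp tmul_r|exact: tmul_r|].
by rewrite !word_cons mergeE.
Qed.

Let merge_nil v : merge v (word [::]) = 0. Proof. exact: mergeE. Qed.

Let sg_d v : sg (dga_d v) = - dga_d (sg v).
Proof.
move: v; apply: gsign_deg1; first exact: dga_d_linear.
by move=> n x; exact: dga_d_deg.
Qed.

Let sg_mul u v : sg (u ** v) = - (sg u ** sg v).
Proof.
move: u; apply: (homog_eq (g := dga_gr Omega)) => [||m u hu].
- exact: linear_comp (gsign_linear _) mul_l.
- exact/linear_opp/(linear_comp mul_l)/gsign_linear.
move: v; apply: (homog_eq (g := dga_gr Omega)) => [||n v hv].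
- exact: linear_comp (gsign_linear _) mul_r.
- exact/linear_opp/(linear_comp mul_r)/gsign_linear.
rewrite !gsign_shift1 (gsign_homog hu) (gsign_homog hv).
rewrite (gsign_homog (dga_mul_deg hu hv)) signD.
rewrite (linear_funN mul_r) (linear_funN mul_l) opprK.
rewrite (linear_funZ mul_r) (linear_funZ mul_l) scalerA.
by rewrite [X in X *: _]mulrC.
Qed.

Let d_mul u v : dga_d (u ** v) = dga_d u ** v - sg u ** dga_d v.
Proof.
move: u; apply: (homog_eq (g := dga_gr Omega)) => [||m u hu].
- exact: linear_comp (@dga_d_linear _ _) mul_l.
- apply: linear_add; first exact: linear_comp mul_l (@dga_d_linear _ _).
  exact/linear_opp/(linear_comp mul_l)/gsign_linear.
rewrite (dga_leibniz _ hu) gsign_shift1 (gsign_homog hu).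
by rewrite (linear_funN mul_l) (linear_funZ mul_l) opprK.
Qed.

Let merge_merge v w x : merge (sg v) (merge w x) = - merge (sg v ** w) x.
Proof.
move: x; apply: tensalg_eq => [||s].
- exact: linear_comp (merge_linear _) (merge_linear _).
- exact/linear_opp/merge_linear.
case: s => [|u s].
  by rewrite !merge_nil (linear_fun0 (merge_linear _)) oppr0.
rewrite -word_cons !merge_cons sg_mul (linear_funN mul_l) dga_mulA.
by rewrite (linear_funN (cons_linear _)) opprK.
Qed.

Let bar_d_merge v x :
  bar_d (merge v x) = - (merge (dga_d v) x + merge (sg v) (bar_d x)).
Proof.
move: x; apply: tensalg_eq => [||s].
- exact: linear_comp bar_d_linear (merge_linear _).
- apply/linear_opp/linear_add; first exact: merge_linear.
  exact: linear_comp (merge_linear _) bar_d_linear.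
case: s => [|w s].
  rewrite !merge_nil bar_d_nil (linear_fun0 bar_d_linear).
  by rewrite (linear_fun0 (merge_linear _)) addr0 oppr0.
rewrite -word_cons !merge_cons !bar_d_cons !(linear_funB (merge_linear _)).
rewrite (linear_funD (merge_linear _)) !merge_cons merge_merge opprK.
rewrite d_mul sg_mul sg_d (linear_funN mul_l).
rewrite (linear_funB (cons_linear _)) !(linear_funN (cons_linear _)).
by rewrite !opprD !opprK !addrA.
Qed.

Lemma bar_dd x : bar_d (bar_d x) = 0.
Proof.
move: x; apply: tensalg_eq => [||s].
- exact: linear_comp bar_d_linear bar_d_linear.
- exact: linear_zero.
elim: s => [|v s IH]; first by rewrite bar_d_nil (linear_fun0 bar_d_linear).
rewrite -word_cons bar_d_cons (linear_funB bar_d_linear).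
rewrite (linear_funD bar_d_linear) !bar_d_cons IH dga_dd bar_d_merge sg_d.
rewrite (linear_fun0 tmul_r) !(linear_fun0 (cons_linear _)).
rewrite (linear_funN (cons_linear _)) add0r addr0 opprK.
set A := tensalg_mul _ _; set B := merge _ _; set C := merge _ _.
have E : A - C + (B + C) = A + B by rewrite [B + C]addrC addrA subrK.
by rewrite -addrA E -opprD addNr.
Qed.

Lemma bar_d_deg n x : homog bar_grading n x -> homog bar_grading (n + 1) (bar_d x).
Proof.
apply: (tensalg_map_deg (Q := homog bar_grading)) n x.
- exact: bar_d_linear.
- exact: homog0.
- by move=> n a x y; apply: homogP.
have merge_deg i v m s : homog gB i v -> homog_word gB m s ->
    homog bar_grading (i + m + 1) (merge_word v s).
  move=> hv; case=> [|j p u t hu ht]; first exact: homog0.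
  apply: homog_tensalg_word.
  have -> : i + (j + p) + 1 = (i + j + 1) + p by rewrite -!addrA [p + 1]addrC.
  constructor=> //; rewrite homog_shift.
  have -> : i + j + 1 + 1 = (i + 1) + (j + 1) by rewrite -!addrA [1 + (j + 1)]addrCA.
  by apply: dga_mul_deg => //; exact: (homog_gsign hv).
move=> n s; elim=> [|i m v t hv ht IH]; first by rewrite bar_d_nil; exact: homog0.
rewrite bar_d_cons1; apply: homogD; first apply: homogD.
- apply: homog_tensalg_word; rewrite addrAC; constructor=> //.
  exact: dga_d_deg.
- rewrite -addrA; apply: tensalg_mul_deg => //.
  exact/homog_word1/homog_gsign.
rewrite -[X in homog _ _ X]scaleN1r; apply: homogZ.
exact: merge_deg.
Qed.

Let T2 := tensor T T.
Let lact (v : Omega) : T2 -> T2 := tensor_map (tensalg_mul (word [:: v])) id.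

Let lact_linear v : linear (lact v).
Proof. exact: (tensor_map_linear tmul_r (@linear_id _ _)). Qed.

Let lactE v x y : lact v (pure x y) = pure (tensalg_mul (word [:: v]) x) y.
Proof. exact: (tensor_mapE _ _ tmul_r (@linear_id _ _)). Qed.

Let deconcat_word_cons v s : deconcat_word (v :: s) =
  pure (word [::]) (word (v :: s)) + lact v (deconcat_word s).
Proof.
rewrite /deconcat_word big_ord_recl /= (linear_fun_sum _ _ _ (lact_linear v)).
by congr (_ + _); apply: eq_bigr => i _; rewrite lactE word_cons.
Qed.

Let lact_comb t : linear (fun v => lact v t).
Proof.
move=> a u w; apply: umod_lift_comb => p.
by rewrite cons_linear pure_linearl.
Qed.

Lemma deconcat_word_multi : multilinear_fun deconcat_word.
Proof.
have comb (A : lmodType k) (a : k) (x y z w : A) :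
    a *: x + y + (a *: z + w) = a *: (x + z) + (y + w).
  by rewrite scalerDr addrACA.
move=> s t; elim: s => [|v0 s IH] a u v; rewrite !deconcat_word_cons.
  have /= -> := word_multilinear [::] t; rewrite lact_comb pure_linearr.
  exact: comb.
rewrite -/cat IH lact_linear; have /= -> := word_multilinear (v0 :: s) t.
by rewrite pure_linearr; exact: comb.
Qed.

Lemma deconcat_linear : linear deconcat.
Proof. exact/tensalg_lift_linear/deconcat_word_multi. Qed.

Lemma deconcatE s : deconcat (word s) = deconcat_word s.
Proof. exact/tensalg_liftE/deconcat_word_multi. Qed.

Let deconcat_nil : deconcat (word [::]) = pure (word [::]) (word [::]).
Proof. by rewrite deconcatE /deconcat_word big_ord_recl big_ord0 addr0. Qed.

Let deconcat_cons v x : deconcat (tensalg_mul (word [:: v]) x) =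
  pure (word [::]) (tensalg_mul (word [:: v]) x) + lact v (deconcat x).
Proof.
move: x; apply: tensalg_eq => [||s].
- exact: linear_comp deconcat_linear tmul_r.
- apply: linear_add; first exact: linear_comp (pure_linearr _) tmul_r.
  exact: linear_comp (lact_linear v) deconcat_linear.
by rewrite word_cons !deconcatE deconcat_word_cons.
Qed.

Lemma bar_counit_multi : multilinear_fun (fun s : seq Omega => (size s == 0)%:R : k^o).
Proof. by move=> s t a u v; rewrite !size_cat !addnS /= scaler0 addr0. Qed.

Lemma bar_counit_linear : linear bar_counit.
Proof. exact/tensalg_lift_linear/bar_counit_multi. Qed.

Lemma bar_counitE s : bar_counit (word s) = (size s == 0)%:R.
Proof. exact/tensalg_liftE/bar_counit_multi. Qed.

Let bar_counit_cons v x : bar_counit (tensalg_mul (word [:: v]) x) = 0.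
Proof.
move: x; apply: tensalg_eq => [||s].
- exact: linear_comp bar_counit_linear tmul_r.
- exact: linear_zero.
by rewrite word_cons bar_counitE.
Qed.

Lemma deconcat_deg n x : homog bar_grading n x ->
  tensor_homog bar_grading bar_grading n (deconcat x).
Proof.
move=> hx; rewrite -[n]addr0; move: n x hx.
apply: (tensalg_map_deg (Q := tensor_homog bar_grading bar_grading)).
- exact: deconcat_linear.
- exact: tensor_homog0.
- by move=> n a x y hx hy; apply: tensor_homogD => //; exact: tensor_homogZ.
move=> n s; rewrite addr0; elim=> [|i m v t hv ht IH].
  rewrite deconcat_nil; apply: (tensor_homog_pure (i := 0) (j := 0)) => //;
  by apply: homog_tensalg_word; constructor.
rewrite -word_cons deconcat_cons; apply: tensor_homogD.
  apply: (tensor_homog_pure (i := 0) (j := i + m)); last by rewrite add0r.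
    by apply: homog_tensalg_word; constructor.
  by rewrite word_cons; apply: homog_tensalg_word; constructor.
have [r [Hr ->]] := IH; rewrite (linear_fun_sum _ _ _ (lact_linear v)) big_seq.
elim/big_rec: _ => [|p y /Hr[h1 h2] hy]; first exact: tensor_homog0.
apply: tensor_homogD => //; rewrite lactE.
apply: (tensor_homog_pure (i := i + p.1) (j := m - p.1)) => //.
  by apply: tensalg_mul_deg => //; exact: homog_word1.
by rewrite addrACA subrr addr0.
Qed.

Lemma bar_counit_deg n x : homog bar_grading n x -> n != 0 -> bar_counit x = 0.
Proof.
move=> hx; rewrite -[n]addr0; move: n x hx.
apply: (tensalg_map_deg (Q := fun n (y : k^o) => n != 0 -> y = 0)).
- exact: bar_counit_linear.
- by [].
- by move=> n a x y hx hy n0; rewrite hx // hy // scaler0 addr0.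
by move=> n s [//|i m v t _ _ _]; rewrite bar_counitE.
Qed.

Lemma deconcat_coassoc x :
  tensor_assoc (tensor_map deconcat id (deconcat x)) =
  tensor_map id deconcat (deconcat x).
Proof.
have lD1 := tensor_map_linear deconcat_linear (@linear_id k T).
have l1D := tensor_map_linear (@linear_id k T) deconcat_linear.
have lA := @tensor_assoc_linear k T T T.
move: x; apply: tensalg_eq => [||s].
- exact/(linear_comp lA)/(linear_comp lD1)/deconcat_linear.
- exact/(linear_comp l1D)/deconcat_linear.
elim: s => [|v s IH].
  rewrite deconcat_nil !tensor_mapE ?deconcat_nil ?tensor_assocE //;
  exact: deconcat_linear.
rewrite -word_cons deconcat_cons; set y := word s in IH *.
rewrite (linear_funD lD1) (linear_funD l1D) (linear_funD lA).
rewrite !tensor_mapE //; try exact: deconcat_linear.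
rewrite deconcat_nil tensor_assocE deconcat_cons (linear_funD (pure_linearr _)).
rewrite -addrA; congr (_ + _).
pose l3 : tensor T T2 -> tensor T T2 := tensor_map (tensalg_mul (word [:: v])) id.
have l3E x z : l3 (pure x z) = pure (tensalg_mul (word [:: v]) x) z.
  exact: (tensor_mapE _ _ tmul_r (@linear_id _ _)).
have ll3 : linear l3 := tensor_map_linear tmul_r (@linear_id _ _).
have -> : tensor_map id deconcat (lact v (deconcat y)) =
    l3 (tensor_map id deconcat (deconcat y)).
  move: (deconcat y); apply: tensor_eq => [||p q].
  - exact: linear_comp l1D (lact_linear v).
  - exact: linear_comp ll3 l1D.
  rewrite lactE !tensor_mapE //; try exact: deconcat_linear.
  by rewrite l3E.
rewrite -IH.
move: (deconcat y); apply: tensor_eq => [||p q].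
- exact/(linear_comp lA)/(linear_comp lD1)/lact_linear.
- apply: linear_add; first exact: linear_comp (pure_linearr _) (lact_linear v).
  exact/(linear_comp ll3)/(linear_comp lA).
rewrite lactE !tensor_mapE //; try exact: deconcat_linear.
rewrite deconcat_cons (linear_funD (pure_linearl _)) (linear_funD lA).
rewrite tensor_assocE; congr (_ + _).
move: (deconcat p); apply: tensor_eq => [||a b].
- exact/(linear_comp lA)/(linear_comp (pure_linearl _))/lact_linear.
- exact/(linear_comp ll3)/(linear_comp lA)/pure_linearl.
by rewrite lactE !tensor_assocE l3E.
Qed.

Let counit_lift_l : (forall y : T, linear (fun x : T => (bar_counit x : k) *: y)) /\
  (forall x : T, linear (fun y : T => (bar_counit x : k) *: y)).
Proof.
split=> [y|x] a u v; last by rewrite scalerDr !scalerA mulrC.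
by rewrite bar_counit_linear scalerDl scalerA.
Qed.

Lemma deconcat_counitl x :
  tensor_lift (fun u v => (bar_counit u : k) *: v) (deconcat x) = x.
Proof.
have [bl br] := counit_lift_l; have ll := tensor_lift_linear bl br.
move: x; apply: tensalg_eq => [|//|s]; first exact: linear_comp ll deconcat_linear.
case: s => [|v s].
  by rewrite deconcat_nil tensor_liftE // bar_counitE scale1r.
rewrite -word_cons deconcat_cons (linear_funD ll) tensor_liftE //.
rewrite bar_counitE scale1r -[RHS]addr0; congr (_ + _).
move: (deconcat (word s)); apply: tensor_eq => [||p q].
- exact: linear_comp ll (lact_linear v).
- exact: linear_zero.
by rewrite lactE tensor_liftE // bar_counit_cons scale0r.
Qed.

Lemma deconcat_counitr x :
  tensor_lift (fun u v => (bar_counit v : k) *: u) (deconcat x) = x.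
Proof.
have [br bl] := counit_lift_l; have ll := tensor_lift_linear bl br.
move: x; apply: tensalg_eq => [|//|s]; first exact: linear_comp ll deconcat_linear.
elim: s => [|v s IH].
  by rewrite deconcat_nil tensor_liftE // bar_counitE scale1r.
rewrite -word_cons deconcat_cons (linear_funD ll) tensor_liftE //.
rewrite bar_counit_cons scale0r add0r -[in RHS]IH.
move: (deconcat (word s)); apply: tensor_eq => [||p q].
- exact: linear_comp ll (lact_linear v).
- exact: linear_comp tmul_r ll.
by rewrite lactE !tensor_liftE // (linear_funZ tmul_r).
Qed.

Lemma bar_d_counit x : bar_counit (bar_d x) = 0.
Proof.
move: x; apply: tensalg_eq => [||s].
- exact: linear_comp bar_counit_linear bar_d_linear.
- exact: linear_zero.
case: s => [|v s]; first by rewrite bar_d_nil (linear_fun0 bar_counit_linear).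
rewrite bar_d_cons1 -word_cons (linear_funB bar_counit_linear).
rewrite (linear_funD bar_counit_linear) !bar_counit_cons addr0 sub0r.
case: s => [|u s] /=; first by rewrite (linear_fun0 bar_counit_linear) oppr0.
by rewrite bar_counitE oppr0.
Qed.

Lemma bar_d_deconcat x : deconcat (bar_d x) =
  tensor_map bar_d id (deconcat x) +
  tensor_map (gsign bar_grading) bar_d (deconcat x).
Proof.
have lS := gsign_linear bar_grading.
have ld1 := tensor_map_linear bar_d_linear (@linear_id k T).
have lsd := tensor_map_linear lS bar_d_linear.
move: x; apply: tensalg_eq => [||s].
- exact: linear_comp deconcat_linear bar_d_linear.
- by apply: linear_add; exact: linear_comp deconcat_linear.
elim: s => [|v s IH].
  rewrite bar_d_nil deconcat_nil !tensor_mapE //; try exact: bar_d_linear.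
  rewrite bar_d_nil (linear_fun0 deconcat_linear).
  by rewrite (linear_fun0 (pure_linearl _)) (linear_fun0 (pure_linearr _)) addr0.
have d1 t : tensor_map bar_d id (lact v t) = lact (dga_d v) t +
    lact (sg v) (tensor_map bar_d id t) - tensor_map (merge v) id t.
  have lm := tensor_map_linear (merge_linear v) (@linear_id k T).
  move: t; apply: tensor_eq => [||p q].
  - exact: linear_comp ld1 (lact_linear v).
  - apply: linear_add; last exact: linear_opp.
    apply: linear_add; first exact: lact_linear.
    exact: linear_comp (lact_linear _) ld1.
  rewrite !lactE !tensor_mapE //; try exact: bar_d_linear; try exact: merge_linear.
  rewrite lactE bar_d_cons (linear_funB (pure_linearl _)).
  by rewrite (linear_funD (pure_linearl _)).
have sd t : tensor_map (gsign bar_grading) bar_d (lact v t) =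
    lact (sg v) (tensor_map (gsign bar_grading) bar_d t).
  move: t; apply: tensor_eq => [||p q].
  - exact: linear_comp lsd (lact_linear v).
  - exact: linear_comp (lact_linear _) lsd.
  rewrite !lactE !tensor_mapE //; try exact: bar_d_linear.
  rewrite lactE; congr pure.
  move: p; apply: tensalg_eq => [||p].
  - exact: linear_comp lS tmul_r.
  - exact: linear_comp tmul_r lS.
  by rewrite word_cons !gsign_word /= word_cons.
have mg : deconcat (merge v (word s)) =
    pure (word [::]) (merge v (word s)) + tensor_map (merge v) id (deconcat (word s)).
  have lm := tensor_map_linear (merge_linear v) (@linear_id k T).
  case: s {IH} => [|w s].
    rewrite deconcat_nil merge_nil tensor_mapE //; try exact: merge_linear.
    rewrite merge_nil (linear_fun0 deconcat_linear) (linear_fun0 (pure_linearl _)).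
    by rewrite (linear_fun0 (pure_linearr _)) addr0.
  rewrite -word_cons merge_cons !deconcat_cons (linear_funD lm).
  rewrite tensor_mapE //; try exact: merge_linear.
  rewrite merge_nil (linear_fun0 (pure_linearl _)) add0r; congr (_ + _).
  move: (deconcat (word s)); apply: tensor_eq => [||p q].
  - exact: lact_linear.
  - exact: linear_comp lm (lact_linear _).
  rewrite !lactE tensor_mapE ?merge_cons //; try exact: merge_linear.
rewrite -word_cons bar_d_cons (linear_funB deconcat_linear).
rewrite (linear_funD deconcat_linear) !deconcat_cons mg IH.
rewrite (linear_funD ld1) (linear_funD lsd) !tensor_mapE //; try exact: bar_d_linear.
rewrite d1 sd gsign_word bar_d_nil /= bar_d_cons.
rewrite (linear_fun0 (pure_linearl _)) add0r.
rewrite (linear_funB (pure_linearr _)) (linear_funD (pure_linearr _)).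
rewrite (linear_funD (lact_linear _)).
by rewrite opprD [LHS](AC ((2*(1*2))*2) ((2*4*7)*(1*3*6*5))).
Qed.

Definition bar : dgCoalgebra k :=
  DGCoalgebra bar_d_linear deconcat_linear bar_counit_linear bar_d_deg
    deconcat_deg bar_counit_deg bar_dd deconcat_coassoc deconcat_counitl
    deconcat_counitr bar_d_deconcat bar_d_counit.
End Bar.


Section Cobar.
Variables (k : fieldType) (K : dgCoalgebra k).
Local Notation gF := (gr_shift (dgc_gr K) (-1)).
Local Notation s0 := (gsign (dgc_gr K)).
Local Notation s1 := (gsign gF).
Local Notation T := (tensalg K).
Local Notation "x ** y" := (@tensalg_mul k K x y) (at level 40, left associativity).
Local Notation d_lin := (@dgc_d_linear k K).
Local Notation D_lin := (@dgc_comul_linear k K).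
Local Notation tmul_l := (tensalg_mul_linearl _).
Local Notation tmul_r := (tensalg_mul_linearr _).

(* s0 is the sign operator of K and s1 that of K[-1], where k has degree
   |k| + 1. *)
Definition cobar_grading : grading T := tensalg_grading gF.

Definition cobar_d_gen (x : K) : T :=
  word [:: dgc_d x] + tensor_lift (fun u v => word [:: s0 u; v]) (dgc_comul x).

Definition cobar_d_word (s : seq K) : T :=
  \sum_(i < size s)
    word (map s1 (take i s)) ** cobar_d_gen s`_i ** word (drop i.+1 s).

Definition cobar_d : T -> T := tensalg_lift cobar_d_word.

Let word2_l (v : K) : linear (fun u : K => word [:: s0 u; v]).
Proof. by move=> a u w; rewrite gsign_linear; have /= -> := word_multilinear [::] [:: v]. Qed.

Let word2_r (u : K) : linear (fun v : K => word [:: s0 u; v]).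
Proof. exact: (word_multilinear [:: s0 u] [::]). Qed.

Let split : tensor K K -> T := tensor_lift (fun u v => word [:: s0 u; v]).

Let split_linear : linear split.
Proof. exact: tensor_lift_linear. Qed.

Let splitE u v : split (pure u v) = word [:: s0 u; v].
Proof. exact: tensor_liftE. Qed.

Lemma cobar_d_gen_linear : linear cobar_d_gen.
Proof.
apply: linear_add; first exact: (linear_comp (@word1_linear k K) d_lin).
exact: linear_comp split_linear D_lin.
Qed.

Let cobar_d_word_cons v s : cobar_d_word (v :: s) =
  cobar_d_gen v ** word s + word [:: s1 v] ** cobar_d_word s.
Proof.
rewrite /cobar_d_word big_ord_recl /= drop0 tensalg_mul1x; congr (_ + _).
rewrite (linear_fun_sum _ _ _ tmul_r); apply: eq_bigr => i _.
by rewrite !tensalg_mulA tensalg_mulE.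
Qed.

Let comb (A : lmodType k) (a : k) (x y z w : A) :
  a *: x + y + (a *: z + w) = a *: (x + z) + (y + w).
Proof. by rewrite scalerDr addrACA. Qed.

Lemma cobar_d_word_multi : multilinear_fun cobar_d_word.
Proof.
move=> s t; elim: s => [|v0 s IH] a u v; rewrite !cobar_d_word_cons.
  rewrite cobar_d_gen_linear tensalg_mul_linearl gsign_linear word1_linear.
  by rewrite tensalg_mul_linearl comb.
rewrite -/cat IH (word_multilinear s t) !tensalg_mul_linearr.
by rewrite comb.
Qed.

Lemma cobar_d_linear : linear cobar_d.
Proof. exact/tensalg_lift_linear/cobar_d_word_multi. Qed.

Let cobar_dE s : cobar_d (word s) = cobar_d_word s.
Proof. exact/tensalg_liftE/cobar_d_word_multi. Qed.

Let cobar_d_nil : cobar_d (word [::]) = 0.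
Proof. by rewrite cobar_dE /cobar_d_word big_ord0. Qed.

Let cobar_d_cons v x : cobar_d (word [:: v] ** x) =
  cobar_d_gen v ** x + word [:: s1 v] ** cobar_d x.
Proof.
move: x; apply: tensalg_eq => [||s].
- exact: linear_comp cobar_d_linear tmul_r.
- apply: linear_add; first exact: tmul_r.
  exact: linear_comp tmul_r cobar_d_linear.
by rewrite tensalg_mulE !cobar_dE cobar_d_word_cons.
Qed.

Lemma cobar_d_word1 v : cobar_d (word [:: v]) = cobar_d_gen v.
Proof.
by rewrite -[word [:: v]]tensalg_mulx1 cobar_d_cons cobar_d_nil
  (linear_fun0 tmul_r) addr0 tensalg_mulx1.
Qed.

Let sF := gsign cobar_grading.

Let sF_cons v x : sF (word [:: v] ** x) = word [:: s1 v] ** sF x.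
Proof.
move: x; apply: tensalg_eq => [||s].
- exact: linear_comp (gsign_linear _) tmul_r.
- exact: linear_comp tmul_r (gsign_linear _).
by rewrite tensalg_mulE /sF !gsign_word /= tensalg_mulE.
Qed.

Let cobar_d_mul x y : cobar_d (x ** y) = cobar_d x ** y + sF x ** cobar_d y.
Proof.
move: x; apply: tensalg_eq => [||s].
- exact: linear_comp cobar_d_linear tmul_l.
- by apply: linear_add; [exact: linear_comp tmul_l cobar_d_linear|exact: linear_comp tmul_l (gsign_linear _)].
elim: s => [|v s IH].
  rewrite tensalg_mul1x cobar_d_nil (linear_fun0 tmul_l) add0r.
  by rewrite /sF gsign_word tensalg_mul1x.
rewrite -[v :: s]cat1s -tensalg_mulE -tensalg_mulA !cobar_d_cons sF_cons IH.
rewrite (linear_funD (tensalg_mul_linearr (word [:: s1 v]))) !tensalg_mulA addrA.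
have E a b : (a + b) ** y = a ** y + b ** y := linear_funD (tensalg_mul_linearl y) a b.
by rewrite (E (cobar_d_gen v ** word s)).
Qed.

Lemma cobar_leibniz n x y : homog cobar_grading n x ->
  cobar_d (x ** y) = cobar_d x ** y + (-1) ^ n *: (x ** cobar_d y).
Proof.
by move=> hx; rewrite cobar_d_mul /sF (gsign_homog hx) (linear_funZ tmul_l).
Qed.

Lemma cobar_d_gen_deg n v : homog gF n v ->
  homog cobar_grading (n + 1) (cobar_d_gen v).
Proof.
move=> hv; apply: homogD.
  apply: homog_word1; rewrite homog_shift addrAC.
  exact: dgc_d_deg.
have [r [Hr ->]] := dgc_comul_deg hv.
rewrite -/split (linear_fun_sum _ _ _ split_linear) big_seq.
elim/big_rec: _ => [|p y /Hr[h1 h2] hy]; first exact: homog0.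
apply: homogD => //; rewrite splitE; apply: homog_tensalg_word.
have -> : n + 1 = (p.1 + 1) + ((n - 1 - p.1 + 1) + 0).
  by rewrite addr0 addrACA [p.1 + _]addrC subrK addrA subrK.
constructor; last by constructor; [rewrite homog_shift addrK|constructor].
by rewrite homog_shift addrK; exact: homog_gsign.
Qed.

Lemma cobar_d_deg n x : homog cobar_grading n x ->
  homog cobar_grading (n + 1) (cobar_d x).
Proof.
apply: (tensalg_map_deg (Q := homog cobar_grading)); first exact: cobar_d_linear.
- exact: homog0.
- by move=> m a y z; apply: homogP.
move=> m s; elim=> [|i p v t hv ht IH]; first by rewrite cobar_d_nil; exact: homog0.
rewrite -[v :: t]cat1s -tensalg_mulE cobar_d_cons; apply: homogD.
  rewrite addrAC; apply: tensalg_mul_deg; first exact: cobar_d_gen_deg.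
  exact: homog_tensalg_word.
rewrite -addrA; apply: tensalg_mul_deg => //.
exact/homog_word1/homog_gsign.
Qed.

Let s0_d v : s0 (dgc_d v) = - dgc_d (s0 v).
Proof. by move: v; apply: gsign_deg1; [exact: d_lin|exact: dgc_d_deg]. Qed.

Let comul_s0 v : dgc_comul (s0 v) = tensor_map s0 s0 (dgc_comul v).
Proof.
have lss := tensor_map_linear (gsign_linear (dgc_gr K)) (gsign_linear (dgc_gr K)).
move: v; apply: (homog_eq (g := dgc_gr K)) => [||n v hv].
- exact: linear_comp D_lin (gsign_linear _).
- exact: linear_comp lss D_lin.
rewrite (gsign_homog hv) (linear_funZ D_lin).
by rewrite (gsign_tensor (dgc_comul_deg hv)).
Qed.

Let s1E v : s1 v = - s0 v. Proof. exact: gsign_shiftN1. Qed.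

Let sF_gen v : sF (cobar_d_gen v) = - cobar_d_gen (s1 v).
Proof.
move: v; apply: gsign_deg1; first exact: cobar_d_gen_linear.
exact: cobar_d_gen_deg.
Qed.

Let cobar_dd_gen v : cobar_d (cobar_d_gen v) = 0.
Proof.
pose tri : tensor K (tensor K K) -> T :=
  tensor_lift (fun x t => word [:: x] ** split t).
have tri_l t : linear (fun x : K => word [:: x] ** split t).
  by move=> a x y; rewrite word1_linear tensalg_mul_linearl.
have tri_r x : linear (fun t : tensor K K => word [:: x] ** split t).
  exact: linear_comp tmul_r split_linear.
have ltri : linear tri := tensor_lift_linear tri_l tri_r.
have triE x t : tri (pure x t) = word [:: x] ** split t by exact: tensor_liftE.
have lD1 := tensor_map_linear D_lin (@linear_id k K).
have l1D := tensor_map_linear (@linear_id k K) D_lin.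
have lA := @tensor_assoc_linear k K K K.
have ld1 := tensor_map_linear d_lin (@linear_id k K).
have lsd := tensor_map_linear (gsign_linear (dgc_gr K)) d_lin.
have dsplit t : cobar_d (split t) =
    - split (tensor_map (@dgc_d k K) id t)
    - split (tensor_map s0 (@dgc_d k K) t)
    + tri (tensor_assoc (tensor_map (@dgc_comul k K) id t))
    - tri (tensor_map id (@dgc_comul k K) t).
  move: t; apply: tensor_eq => [||u w].
  - exact: linear_comp cobar_d_linear split_linear.
  - apply: linear_add; last exact/linear_opp/(linear_comp ltri).
    apply: linear_add; last exact/(linear_comp ltri)/(linear_comp lA).
    apply: linear_add; apply/linear_opp/(linear_comp split_linear) => //.
  rewrite !tensor_mapE //; try exact: d_lin; try exact: D_lin; try exact: gsign_linear.
  rewrite !splitE triE -[[:: s0 u; w]]cat1s -tensalg_mulE cobar_d_cons cobar_d_word1.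
  rewrite s1E gsignK s0_d (linear_funN (@word1_linear k K)) (linear_funN tmul_l).
  rewrite /cobar_d_gen -/split comul_s0 (linear_funD tmul_l) (linear_funD tmul_r).
  have -> : split (tensor_map s0 s0 (dgc_comul u)) ** word [:: w] =
      tri (tensor_assoc (pure (dgc_comul u) w)).
    move: (dgc_comul u); apply: tensor_eq => [||a b].
    - by apply/(linear_comp tmul_l)/(linear_comp split_linear)/tensor_map_linear; exact: gsign_linear.
    - exact/(linear_comp ltri)/(linear_comp lA)/pure_linearl.
    rewrite tensor_assocE triE tensor_mapE; try exact: gsign_linear.
    by rewrite !splitE gsignK !tensalg_mulE.
  rewrite !tensalg_mulE opprD /=.
  have /= ->:= linear_funN (word_multilinear [::] [:: w]) (dgc_d (s0 u)).
  by rewrite opprK addrACA addrA.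
rewrite {1}/cobar_d_gen -/split (linear_funD cobar_d_linear) cobar_d_word1.
rewrite dsplit dgc_coassoc /cobar_d_gen -/split dgc_dd.
rewrite (linear_fun0 (@word1_linear k K)) add0r dgc_d_comul (linear_funD split_linear).
by rewrite addrK -opprD subrr.
Qed.

Lemma cobar_dd x : cobar_d (cobar_d x) = 0.
Proof.
move: x; apply: tensalg_eq => [||s].
- exact: linear_comp cobar_d_linear cobar_d_linear.
- exact: linear_zero.
elim: s => [|v s IH]; first by rewrite cobar_d_nil (linear_fun0 cobar_d_linear).
rewrite -[v :: s]cat1s -tensalg_mulE cobar_d_cons (linear_funD cobar_d_linear).
rewrite cobar_d_cons cobar_d_mul IH cobar_dd_gen sF_gen (linear_funN tmul_l).
by rewrite (linear_fun0 tmul_l) (linear_fun0 tmul_r) add0r addr0 addNr.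
Qed.

Lemma cobar_one_deg : homog cobar_grading 0 (word [::]).
Proof. by apply: homog_tensalg_word; constructor. Qed.

Definition cobar : dgAlgebra k :=
  DGAlgebra cobar_d_linear (@tensalg_mul_linearl k K) (@tensalg_mul_linearr k K)
    cobar_d_deg (@tensalg_mul_deg k K gF) cobar_one_deg cobar_dd
    (@tensalg_mulA k K) (@tensalg_mul1x k K) (@tensalg_mulx1 k K) cobar_leibniz.
End Cobar.

Section TwistingCochain.
Variables (k : fieldType) (K : coaugDGCoalgebra k) (Omega : dgAlgebra k).

(* phi * phi *)
Definition conv_square (phi : K -> Omega) (x : K) : Omega :=
  tensor_lift (fun u v => dga_mul (phi (gsign (dgc_gr K) u)) (phi v)) (dgc_comul x).

Record twisting_cochain (phi : K -> Omega) : Prop := TwistingCochain {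
  twisting_linear : linear phi;
  twisting_deg : forall n x, homog (dgc_gr K) n x ->
    homog (dga_gr Omega) (n + 1) (phi x);
  twisting_coaug : forall c, phi (coaug K c) = 0;
  twisting_eq : forall x,
    dga_d (phi x) - phi (dgc_d x) - conv_square phi x = 0 }.

(* iter_comul n x is the sum of the [x^(1)|...|x^(n+1)]. *)
Fixpoint iter_comul (n : nat) (x : K) : tensalg K :=
  if n is m.+1 then
    tensor_lift (fun u v => tensalg_mul (word [:: u]) (iter_comul m v)) (dgc_comul x)
  else word [:: x].

Definition char_term (phi : K -> Omega) (n : nat) (x : K) : bar Omega :=
  if n is m.+1 then tensalg_lift (fun s => word (map phi s)) (iter_comul m x)
  else (dgc_counit x : k) *: word [::].

(* The sum has its intended meaning when only finitely many terms are non-zero,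
   and is 0 by convention otherwise. *)
Definition char_map (phi : K -> Omega) (x : K) : bar Omega :=
  \sum_(n \in [set: nat]%classic) char_term phi n x.

Definition cochar_map (phi : K -> Omega) : cobar K -> Omega :=
  tensalg_lift (fun s => \big[@dga_mul k Omega / dga_one Omega]_(x <- s) phi x).

End TwistingCochain.

(* Main.v *)
Require Import Defs.
From mathcomp Require Import all_boot all_order all_algebra.
From mathcomp Require Import boolp classical_sets cardinality.
From mathcomp Require Import fsbigop.
Import GRing.Theory.
Local Open Scope ring_scope.

(** Write psi_n for the n-th term of the characteristic map: up to the counit
for n = 0, psi_n(x) is the sum of the [phi(x1)|...|phi(xn)].  Counitality turns
its definition into the recursion psi_(n+1)(x) = sum [phi(x1)] psi_n(x2)
([char_termS]), and every statement about psi_n is an induction along it.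

Comultiplication: let cut_p be the map that splits a word after its p-th letter.
Coassociativity gives (psi_p (x) psi_q) Delta = cut_p psi_(p+q)
([char_term_cut]), while deconcatenation is the sum of the cut_p with p <= n on
words of length n.  Hence both sides of the identity for psi are sums of
the (psi_p (x) psi_q) Delta over all p and q.

Differential: the bar differential splits into an inner part, which applies
d to one letter, and an outer part, which multiplies two neighbours and shortens
words by one letter.  The outer part of psi_(n+1) is, with Koszul
signs, minus the sum of the [phi(x1)|...|(phi * phi)(xi)|...|phi(xn)], so by the twisting equation inner
psi_n + outer psi_(n+1) = psi_n d ([char_term_d]).  The signs agree because
phi has degree 1: the sign of phi(x) in Omega[1] is (-1)^|x| ([phi_sign]).
Summed over n this is the compatibility of psi with the differentials.

All sums are finite on each element, and on each element of K (x) K, so that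
they may be cut off at a common bound.

For the cobar construction, the extension of phi to words is multiplicative, so
by the Leibniz rule it commutes with the differentials as soon as it does on
generators.  There, the condition is the twisting equation once more
([cochar_d_gen]). *)

(** * Linear maps out of a tensor product *)

Section TensorLift.
Set Implicit Arguments.
Unset Strict Implicit.
Variable k : fieldType.
Implicit Types U V W : lmodType k.

(** By definition [tensor_lift f t] is a finite sum of values of [f] over a
representative of [t].  So this and the next three lemmas hold for any [f],
without bilinearity: sums in Sweedler notation are handled like finite sums. *)
Lemma eq_tensor_lift V W U (f g : V -> W -> U) t :
  (forall v w, f v w = g v w) -> tensor_lift f t = tensor_lift g t.
Proof.
by move=> fg; congr (tensor_lift _ t); apply/funext => v; apply/funext => w.
Qed.

Lemma linear_tensor_lift V W U U' (h : U -> U') (f : V -> W -> U) t :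
  linear h -> h (tensor_lift f t) = tensor_lift (fun v w => h (f v w)) t.
Proof.
move=> lh; rewrite /tensor_lift /umod_lift /umod_eval (linear_fun_sum _ _ _ lh).
by apply: eq_bigr => p _; rewrite (linear_funZ lh).
Qed.

Lemma tensor_liftD V W U (f g : V -> W -> U) t :
  tensor_lift f t + tensor_lift g t = tensor_lift (fun v w => f v w + g v w) t.
Proof.
have := @umod_lift_comb _ _ (@bilinear_fun k V W) U (fun p => f p.1 p.2)
  (fun p => g p.1 p.2) (fun p => f p.1 p.2 + g p.1 p.2) 1 t.
by rewrite /tensor_lift scale1r => -> // p; rewrite scale1r.
Qed.

Lemma tensor_liftN V W U (f : V -> W -> U) t :
  - tensor_lift f t = tensor_lift (fun v w => - f v w) t.
Proof. by apply: linear_tensor_lift; exact: linear_opp. Qed.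

Lemma tensor_lift_map V W V' W' U (f : V -> V') (g : W -> W')
    (b : V' -> W' -> U) t :
  (forall w, linear (b^~ w)) -> (forall v, linear (b v)) ->
  tensor_lift b (tensor_map f g t) = tensor_lift (fun v w => b (f v) (g w)) t.
Proof.
move=> bl br; rewrite [tensor_map _ _ _]/tensor_map.
rewrite (linear_tensor_lift _ _ (tensor_lift_linear bl br)).
by apply: eq_tensor_lift => v w; rewrite tensor_liftE.
Qed.

Lemma linear_tensor_lift_param U' V W U (f : U' -> V -> W -> U) t :
  (forall v w, linear (fun u => f u v w)) ->
  linear (fun u => tensor_lift (f u) t).
Proof. by move=> lf a x y; apply: umod_lift_comb => p; rewrite lf. Qed.

(** Coassociativity in Sweedler notation: the sums of the F(x1, x2, x3) formed
with either iterated coproduct agree.  Both are images of an element of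
K (x) (K (x) K) under the linear map induced by [F]. *)
Lemma comul_coassoc (K : dgCoalgebra k) U (F : K -> K -> K -> U) x :
  (forall v w, linear (fun u => F u v w)) ->
  (forall u w, linear (fun v => F u v w)) ->
  (forall u v, linear (F u v)) ->
  tensor_lift (fun u v => tensor_lift (F u) (dgc_comul v)) (dgc_comul x) =
  tensor_lift (fun u v => tensor_lift (fun u1 u2 => F u1 u2 v) (dgc_comul u))
    (dgc_comul x).
Proof.
move=> l1 l2 l3.
pose G := tensor_lift (fun u (t : tensor K K) => tensor_lift (F u) t).
have Gl t : linear (fun u => tensor_lift (F u) t) by exact: linear_tensor_lift_param.
have Gr u : linear (tensor_lift (F u)) by apply: tensor_lift_linear.
have lG : linear G by exact: tensor_lift_linear.
have lA := @tensor_assoc_linear k K K K.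
transitivity (G (tensor_map id (@dgc_comul k K) (dgc_comul x))).
  by rewrite /G tensor_lift_map.
rewrite -dgc_coassoc [tensor_map _ _ _]/tensor_map.
rewrite (linear_tensor_lift _ _ lA) (linear_tensor_lift _ _ lG).
apply: eq_tensor_lift => u v.
have lGA : linear (fun t => G (tensor_assoc (pure t v))).
  exact/(linear_comp lG)/(linear_comp lA)/pure_linearl.
move: (dgc_comul u); apply: tensor_eq => // [|u1 u2].
  by apply: tensor_lift_linear.
by rewrite tensor_assocE /G !tensor_liftE.
Qed.

End TensorLift.

(** * The differential of the unit and a triangular sum *)

(** The Leibniz rule for 1 = 1 * 1 reads d 1 = d 1 + d 1. *)
Lemma dga_d_one (k : fieldType) (A : dgAlgebra k) : dga_d (dga_one A) = 0.
Proof.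
have := dga_leibniz (dga_one A) (dga_one_deg A).
rewrite dga_mul1x dga_mulx1 expr0z scale1r dga_mul1x => H.
by apply: (addrI (dga_d (dga_one A))); rewrite addr0 -H.
Qed.

(** When the values at n >= M vanish, the triangle p <= n < M and the square
p, q < M carry the same non-zero terms with n = p + q: what the square has in excess
lies beyond M. *)
Lemma sum_triangle (U : nmodType) (G : nat -> nat -> U) M :
  (forall p n, (M <= n)%N -> G p n = 0) ->
  \sum_(n < M) \sum_(p < n.+1) G p n = \sum_(p < M) \sum_(q < M) G p (p + q)%N.
Proof.
move=> G0; transitivity (\sum_(n < M) \sum_(p < M | (p <= n)%N) G p n).
  by apply: eq_bigr => n _; rewrite (big_ord_widen M (G^~ n)).
rewrite (exchange_big_dep xpredT) //=; apply: eq_bigr => -[p pM] _ /=.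
rewrite -(big_geq_mkord p M xpredT (G p)).
under [RHS]eq_bigr => q _ do rewrite addnC.
rewrite -(big_mkord xpredT (fun q => G p (q + p)%N)).
rewrite -[M in RHS](addnK p) -(big_addn 0 (M + p) p xpredT (G p)) add0n.
rewrite [RHS](big_cat_nat (n := M)) /= ?leq_addr //; last exact: ltnW.
rewrite [X in _ = _ + X]big_nat_cond [X in _ = _ + X]big1 ?addr0 // => n.
by case/andP => /andP[/G0 ->].
Qed.

Section TwistingCochain.
Set Implicit Arguments.
Unset Strict Implicit.
Variables (k : fieldType) (K : coaugDGCoalgebra k) (Omega : dgAlgebra k).
Variables (phi : K -> Omega) (hphi : twisting_cochain phi).
Local Notation "x ** y" := (@dga_mul k Omega x y) (at level 40, left associativity).
Local Notation gK := (dgc_gr K).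
Local Notation prod_phi s := (\big[@dga_mul k Omega / dga_one Omega]_(x <- s) phi x).
Local Notation lphi := (twisting_linear hphi).
Local Notation mul_l := (@dga_mul_linearl k Omega _).
Local Notation mul_r := (@dga_mul_linearr k Omega _).

(** * Twisting cochains *)

Lemma twisting_d x :
  dga_d (phi x) = phi (dgc_d x) + conv_square phi x.
Proof.
by apply/eqP; rewrite -subr_eq0 opprD addrA (twisting_eq hphi).
Qed.

(** Both sides are (-1)^|x| phi(x): [phi] raises the degree by 1, and the shift
lowers it again. *)
Lemma phi_sign x : phi (gsign gK x) = gsign (gr_shift (dga_gr Omega) 1) (phi x).
Proof. by rewrite gsign_shift1 (gsign_deg1 lphi (twisting_deg hphi)) opprK. Qed.

Let mul_phi_linear y : linear (fun u => phi u ** y).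
Proof. exact: linear_comp mul_l lphi. Qed.

(** * The map from the cobar construction *)

Lemma cochar_multi : multilinear_fun (fun s => prod_phi s).
Proof.
move=> s t; elim: s => [|v0 s IH] a u v /=; rewrite !big_cons.
  by rewrite mul_phi_linear.
by rewrite -/cat IH mul_r.
Qed.

Lemma cochar_linear : linear (cochar_map phi).
Proof. exact/tensalg_lift_linear/cochar_multi. Qed.

Lemma cochar_word s : cochar_map phi (word s) = prod_phi s.
Proof. exact/tensalg_liftE/cochar_multi. Qed.

Lemma cochar_mul x y :
  cochar_map phi (tensalg_mul x y) = cochar_map phi x ** cochar_map phi y.
Proof.
move: x; apply: tensalg_eq => [||s].
- exact: linear_comp cochar_linear (tensalg_mul_linearl _).
- exact: linear_comp mul_l cochar_linear.
move: y; apply: tensalg_eq => [||t].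
- exact: linear_comp cochar_linear (tensalg_mul_linearr _).
- exact: linear_comp mul_r cochar_linear.
rewrite tensalg_mulE !cochar_word.
elim: s => [|v s IH]; first by rewrite big_nil dga_mul1x.
by rewrite cat_cons !big_cons IH dga_mulA.
Qed.

Lemma cochar_deg n x : homog (dga_gr (cobar K)) n x ->
  homog (dga_gr Omega) n (cochar_map phi x).
Proof.
move=> hx; rewrite -[n]addr0; move: n x hx.
apply: (tensalg_map_deg (Q := homog (dga_gr Omega))) => [|n|n a x y|n s hs].
- exact: cochar_linear.
- exact: homog0.
- exact: homogP.
rewrite addr0 cochar_word; elim: hs => [|i m v t hv _ IH].
  by rewrite big_nil; exact: dga_one_deg.
rewrite big_cons; apply: dga_mul_deg => //.
by have := twisting_deg hphi hv; rewrite subrK.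
Qed.

(** On generators, compatibility with the differentials is the twisting equation. *)
Lemma cochar_d_gen v : cochar_map phi (cobar_d_gen v) = dga_d (phi v).
Proof.
rewrite /cobar_d_gen (linear_funD cochar_linear) cochar_word big_cons big_nil dga_mulx1.
rewrite (linear_tensor_lift _ _ cochar_linear) twisting_d; congr (_ + _).
by apply: eq_tensor_lift => u w; rewrite cochar_word !big_cons big_nil dga_mulx1.
Qed.

(** Both differentials satisfy the Leibniz rule with the same signs, since a letter
v of degree |v| + 1 is sent to phi(v) of that degree. *)
Lemma cochar_d x : cochar_map phi (cobar_d x) = dga_d (cochar_map phi x).
Proof.
move: x; apply: tensalg_eq => [||s].
- exact: linear_comp cochar_linear (@cobar_d_linear k K).
- exact: linear_comp (@dga_d_linear k Omega) cochar_linear.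
elim/(tensalg_homog_ind (g := gr_shift gK (-1))): (word s) => [|a x y Hx Hy|n t ht].
- rewrite (linear_fun0 (@cobar_d_linear k K)) (linear_fun0 cochar_linear).
  by rewrite (linear_fun0 (@dga_d_linear k Omega)).
- by rewrite cobar_d_linear !cochar_linear dga_d_linear Hx Hy.
elim: ht => [|i m v u hv _ IH].
  have -> : cobar_d (word [::]) = 0 :> tensalg K by exact: dga_d_one (cobar K).
  rewrite (linear_fun0 cochar_linear).
  by rewrite cochar_word big_nil dga_d_one.
have hphiv : homog (dga_gr Omega) i (phi v).
  by have := twisting_deg hphi hv; rewrite subrK.
rewrite -[v :: u]cat1s -tensalg_mulE (cobar_leibniz _ (homog_word1 hv)).
rewrite (linear_funD cochar_linear) (linear_funZ cochar_linear) !cochar_mul IH.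
rewrite cobar_d_word1 cochar_d_gen (cochar_word [:: v]) big_cons big_nil dga_mulx1.
by rewrite (dga_leibniz _ hphiv).
Qed.

Lemma cochar_map_hom : is_dga_hom (A := cobar K) (cochar_map phi).
Proof.
split; [exact: cochar_linear|exact: cochar_deg|exact: cochar_d|exact: cochar_mul|].
by rewrite cochar_word big_nil.
Qed.

(** * The terms of the characteristic map *)

Local Notation T := (tensalg Omega).
Local Notation sg := (gsign (gr_shift (dga_gr Omega) 1)).
Local Notation lcons v y := (tensalg_mul (word [:: v]) y).
Local Notation tmul_l := (tensalg_mul_linearl _).
Local Notation tmul_r := (tensalg_mul_linearr _).

Let letter_linear (y : T) : linear (fun v : Omega => lcons v y).
Proof. exact: linear_comp tmul_l (@word1_linear k Omega). Qed.

Let phi_letter_linear (y : T) : linear (fun u => lcons (phi u) y).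
Proof. exact: linear_comp (letter_linear y) lphi. Qed.

Let word_cons (v : Omega) s : lcons v (word s) = word (v :: s).
Proof. exact: tensalg_mulE. Qed.

(* [T] is the module underlying [bar Omega]; the cast lets the linear structure
   of [T] be used on the terms. *)
Local Notation psi := (char_term phi : nat -> K -> T).

Lemma char_term0 x : psi 0 x = (dgc_counit x : k) *: word [::].
Proof. by []. Qed.

(** The recursion along which all inductions run; for n = 0 it is the right
counit axiom. *)
Lemma char_termS n x :
  psi n.+1 x = tensor_lift (fun u v => lcons (phi u) (psi n v)) (dgc_comul x).
Proof.
have lm : linear (tensalg_lift (fun s => word (map phi s)) : tensalg K -> T).
  exact/tensalg_lift_linear/map_multi/lphi.
have mE s : tensalg_lift (fun s => word (map phi s)) (word s) = word (map phi s) :> T.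
  exact/tensalg_liftE/map_multi/lphi.
case: n => [|n] /=; last first.
  rewrite (linear_tensor_lift _ _ lm); apply: eq_tensor_lift => u v.
  move: (iter_comul n v); apply: tensalg_eq => [||s].
  - exact: linear_comp lm (tensalg_mul_linearr _).
  - exact: linear_comp tmul_r lm.
  by rewrite tensalg_mulE !mE word_cons.
have lw : linear (fun y => word [:: phi y] : T).
  exact: linear_comp (@word1_linear k Omega) lphi.
rewrite mE /= -[in LHS](dgc_counitr x) (linear_tensor_lift _ _ lw).
apply: eq_tensor_lift => u v.
by rewrite (linear_funZ lw) (linear_funZ tmul_r) word_cons.
Qed.

Lemma char_term_linear n : linear (psi n).
Proof.
elim: n => [|n IH] a x y.
  by rewrite !char_term0 dgc_counit_linear scalerDl scalerA.
rewrite !char_termS dgc_comul_linear.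
by apply: tensor_lift_linear => [v|u]; [|exact: linear_comp tmul_r IH].
Qed.

(** psi_n takes values in the span of the words of length n, on which linear maps
are determined by their values on words. *)
Lemma char_term_eq (U : lmodType k) (f h : T -> U) n x : linear f -> linear h ->
  (forall s, size s = n -> f (word s) = h (word s)) -> f (psi n x) = h (psi n x).
Proof.
elim: n x f h => [|n IH] x f h lf lh E.
  by rewrite char_term0 (linear_funZ lf) (linear_funZ lh) E.
rewrite char_termS (linear_tensor_lift _ _ lf) (linear_tensor_lift _ _ lh).
apply: eq_tensor_lift => u v.
apply: (IH v (fun y => f (lcons (phi u) y)) (fun y => h (lcons (phi u) y))).
- exact: linear_comp lf tmul_r.
- exact: linear_comp lh tmul_r.
by move=> s sn; rewrite word_cons E //= sn.
Qed.

Lemma char_term_deg n m x : homog gK m x ->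
  homog (bar_grading Omega) m (psi n x).
Proof.
elim: n m x => [|n IH] m x hx.
  rewrite char_term0; have [->|m0] := eqVneq m 0.
    by apply: homogZ; apply: homog_tensalg_word; constructor.
  by rewrite (dgc_counit_deg hx m0) scale0r; exact: homog0.
have lb : linear (tensor_lift (fun u v => lcons (phi u) (psi n v))).
  apply: tensor_lift_linear => // u; exact: linear_comp tmul_r (char_term_linear n).
rewrite char_termS; have [r [Hr ->]] := dgc_comul_deg hx.
rewrite (linear_fun_sum _ _ _ lb) big_seq.
elim/big_rec: _ => [|p y /Hr[h1 h2] hy]; first exact: homog0.
apply: homogD => //; rewrite tensor_liftE //; last first.
  by move=> u; exact: linear_comp tmul_r (char_term_linear n).
rewrite -[m](subrK p.1) addrC; apply: tensalg_mul_deg; last exact: IH.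
apply: homog_word1; rewrite homog_shift; exact: (twisting_deg hphi).
Qed.

(** * Comultiplication *)

Local Notation T2 := (tensor T T).
Let lact (v : Omega) : T2 -> T2 := tensor_map (tensalg_mul (word [:: v])) id.

Let lact_linear v : linear (lact v).
Proof. exact: (tensor_map_linear tmul_r (@linear_id _ _)). Qed.

Let lactE v x y : lact v (pure x y) = pure (lcons v x) y.
Proof. exact: (tensor_mapE _ _ tmul_r (@linear_id _ _)). Qed.

Definition cut_word (p : nat) (s : seq Omega) : T2 :=
  pure (word (take p s)) (word (drop p s)).

Definition cut (p : nat) : T -> T2 := tensalg_lift (cut_word p).

Let cut_word_cons p v s : cut_word p.+1 (v :: s) = lact v (cut_word p s).
Proof. by rewrite /cut_word lactE word_cons. Qed.

Lemma cut_multi p : multilinear_fun (cut_word p).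
Proof.
move=> s t; elim: s p => [|w s IH] [|p] a u v /=.
- rewrite /cut_word !take0 !drop0.
  by have /= -> := word_multilinear [::] t; rewrite pure_linearr.
- rewrite /cut_word /=.
  by have /= -> := word_multilinear [::] (take p t); rewrite pure_linearl.
- rewrite /cut_word !take0 !drop0.
  by have /= -> := word_multilinear (w :: s) t; rewrite pure_linearr.
by rewrite !cut_word_cons IH lact_linear.
Qed.

Lemma cut_linear p : linear (cut p).
Proof. exact/tensalg_lift_linear/cut_multi. Qed.

Lemma cutE p s : cut p (word s) = cut_word p s.
Proof. exact/tensalg_liftE/cut_multi. Qed.

Lemma cut0 y : cut 0 y = pure (word [::]) y.
Proof.
move: y; apply: tensalg_eq => [||s]; [exact: cut_linear|exact: pure_linearr|].
by rewrite cutE /cut_word take0 drop0.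
Qed.

Lemma cut_cons p v y : cut p.+1 (lcons v y) = lact v (cut p y).
Proof.
move: y; apply: tensalg_eq => [||s].
- exact: linear_comp (cut_linear _) tmul_r.
- exact: linear_comp (lact_linear v) (cut_linear _).
by rewrite word_cons !cutE cut_word_cons.
Qed.

Lemma deconcat_char_term n x :
  deconcat (psi n x) = \sum_(p < n.+1) cut p (psi n x).
Proof.
apply: (char_term_eq (h := fun y => \sum_(p < n.+1) cut p y)) => [||s sn].
- exact: deconcat_linear.
- move=> a y z; rewrite scaler_sumr -big_split /=.
  by apply: eq_bigr => p _; rewrite cut_linear.
by rewrite deconcatE /deconcat_word sn; apply: eq_bigr => p _; rewrite cutE.
Qed.

(** The first p and the last q factors of the iterated coproduct are those of x1
and x2: coassociativity, by induction on p. In particular the left side vanishes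
when psi_(p+q)(x) does. *)
Lemma char_term_cut p q x :
  tensor_map (psi p) (psi q) (dgc_comul x) = cut p (psi (p + q)%N x).
Proof.
rewrite /tensor_map; elim: p x => [|p IH] x.
  have l1 : linear (fun y => pure (word [::] : T) (psi q y)).
    exact: linear_comp (pure_linearr _) (char_term_linear q).
  rewrite cut0 add0n -[in RHS](dgc_counitl x) (linear_tensor_lift _ _ l1).
  apply: eq_tensor_lift => u v.
  by rewrite char_term0 (linear_funZ (pure_linearl _)) (linear_funZ l1).
rewrite addSn char_termS (linear_tensor_lift _ _ (cut_linear _)).
transitivity (tensor_lift (fun u v => tensor_lift (fun v1 v2 =>
    pure (lcons (phi u) (psi p v1)) (psi q v2)) (dgc_comul v)) (dgc_comul x)).
  rewrite comul_coassoc => [|v w|u w|u v].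
  - apply: eq_tensor_lift => u v.
    by rewrite char_termS (linear_tensor_lift _ _ (pure_linearl _)).
  - exact: linear_comp (pure_linearl _) (phi_letter_linear _).
  - apply: linear_comp (pure_linearl _) _.
    exact: linear_comp tmul_r (char_term_linear p).
  - exact: linear_comp (pure_linearr _) (char_term_linear q).
apply: eq_tensor_lift => u v.
rewrite cut_cons -IH (linear_tensor_lift _ _ (lact_linear _)).
by apply: eq_tensor_lift => v1 v2; rewrite lactE.
Qed.

(** * Differential *)

Fixpoint inner_d_word (s : seq Omega) : T :=
  if s is v :: t then word (dga_d v :: t) + lcons (sg v) (inner_d_word t) else 0.

(** The part of the bar differential that applies d to the letters. *)
Definition inner_d : T -> T := tensalg_lift inner_d_word.

Lemma inner_d_multi : multilinear_fun inner_d_word.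
Proof.
have comb (a : k) (x y z w : T) :
    a *: x + y + (a *: z + w) = a *: (x + z) + (y + w).
  by rewrite scalerDr addrACA.
move=> s t; elim: s => [|w s IH] a u v /=.
  rewrite dga_d_linear gsign_linear letter_linear.
  by have /= -> := word_multilinear [::] t; exact: comb.
rewrite IH tmul_r; have /= -> := word_multilinear (dga_d w :: s) t.
exact: comb.
Qed.

Lemma inner_d_linear : linear inner_d.
Proof. exact/tensalg_lift_linear/inner_d_multi. Qed.

Let inner_dE s : inner_d (word s) = inner_d_word s.
Proof. exact/tensalg_liftE/inner_d_multi. Qed.

Let inner_d_cons v y :
  inner_d (lcons v y) = lcons (dga_d v) y + lcons (sg v) (inner_d y).
Proof.
move: y; apply: tensalg_eq => [||s].
- exact: linear_comp inner_d_linear tmul_r.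
- apply: linear_add; first exact: tmul_r.
  exact: linear_comp tmul_r inner_d_linear.
by rewrite !word_cons !inner_dE.
Qed.

(** The part of the bar differential that multiplies neighbouring letters. *)
Definition outer_d (y : T) : T := bar_d y - inner_d y.

Lemma outer_d_linear : linear outer_d.
Proof.
by apply: linear_add; [exact: bar_d_linear|exact/linear_opp/inner_d_linear].
Qed.

Let outer_d_nil : outer_d (word [::]) = 0.
Proof. by rewrite /outer_d inner_dE bar_dE /bar_d_word !big_ord0 !subr0. Qed.

Let outer_d_word1 v : outer_d (word [:: v]) = 0.
Proof.
rewrite /outer_d inner_dE bar_dE /bar_d_word !big_ord1 big_ord0 /=.
by rewrite (linear_fun0 tmul_r) subr0 addr0 subrr.
Qed.

Let bar_d_word_cons2 u v s : bar_d_word (u :: v :: s) =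
  word [:: dga_d u, v & s] + lcons (sg u) (bar_d_word (v :: s))
  - word (sg u ** v :: s).
Proof.
rewrite {1}/bar_d_word big_ord_recl [X in _ - X]big_ord_recl /= !drop0.
rewrite (linear_funB tmul_r) !(linear_fun_sum _ _ _ tmul_r) -!addrA.
congr (_ + _); rewrite opprD addrA addrAC -addrA; congr (_ + (_ + _)).
  by apply: eq_bigr => i _; rewrite word_cons.
by congr (- _); apply: eq_bigr => i _; rewrite word_cons.
Qed.

Let outer_d_cons2 u v y : outer_d (lcons u (lcons v y)) =
  lcons (sg u) (outer_d (lcons v y)) - lcons (sg u ** v) y.
Proof.
move: y; apply: tensalg_eq => [||s].
- apply: linear_comp outer_d_linear _; exact: linear_comp tmul_r tmul_r.
- apply: linear_add; last exact/linear_opp/tmul_r.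
  apply: linear_comp tmul_r _; exact: linear_comp outer_d_linear tmul_r.
rewrite !word_cons /outer_d !bar_dE !inner_dE bar_d_word_cons2.
rewrite -[inner_d_word (u :: _)]/(word (dga_d u :: v :: s) +
  lcons (sg u) (inner_d_word (v :: s))).
move: (bar_d_word _) (inner_d_word _) => b i.
by rewrite (linear_funB tmul_r) opprD [LHS](AC (3*2) ((1*4)*(2*5*3))) /= subrr add0r.
Qed.

Let outer_d_cons v n x : outer_d (lcons v (psi n.+1 x)) =
  lcons (sg v) (outer_d (psi n.+1 x)) -
  tensor_lift (fun u w => lcons (sg v ** phi u) (psi n w)) (dgc_comul x).
Proof.
have lcd a : linear (fun y => outer_d (lcons a y)).
  exact: linear_comp outer_d_linear tmul_r.
have lc : linear (fun y => lcons (sg v) (outer_d y)).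
  exact: linear_comp tmul_r outer_d_linear.
rewrite char_termS (linear_tensor_lift _ _ (lcd v)) (linear_tensor_lift _ _ lc).
rewrite tensor_liftN tensor_liftD; apply: eq_tensor_lift => u w.
exact: outer_d_cons2.
Qed.

(** Both terms on the left are sums over words of length n, although the second
comes from words of length n + 1.  In the inductive step, the product of the
first two letters gives (phi * phi)(x1) by coassociativity; the twisting equation
combines it with d phi(x1) to phi(d x1). *)
Lemma char_term_d n x :
  inner_d (psi n x) + outer_d (psi n.+1 x) = psi n (dgc_d x).
Proof.
elim: n x => [|n IH] x.
  rewrite !char_term0 dgc_d_counit scale0r (linear_funZ inner_d_linear) inner_dE.
  rewrite scaler0 add0r char_termS (linear_tensor_lift _ _ outer_d_linear).
  transitivity (tensor_lift (fun _ _ : K => 0 : T) (dgc_comul x)).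
    apply: eq_tensor_lift => u v; rewrite char_term0 (linear_funZ tmul_r).
    by rewrite word_cons (linear_funZ outer_d_linear) outer_d_word1 scaler0.
  by rewrite -(linear_tensor_lift (fun _ _ => 0 : T) _ (@linear_zero k T T)).
have lr u : linear (fun v => lcons (phi u) (psi n v)).
  exact: linear_comp tmul_r (char_term_linear n).
rewrite [psi n.+1 (dgc_d x)]char_termS dgc_d_comul.
rewrite (linear_funD (tensor_lift_linear _ lr)) ?tensor_lift_map //.
rewrite tensor_liftD char_termS (linear_tensor_lift _ _ inner_d_linear).
rewrite [psi n.+2 x]char_termS (linear_tensor_lift _ _ outer_d_linear).
transitivity (tensor_lift (fun u v => lcons (dga_d (phi u)) (psi n v) +
    lcons (sg (phi u)) (psi n (dgc_d v))) (dgc_comul x) -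
  tensor_lift (fun u v => tensor_lift (fun v1 v2 =>
    lcons (sg (phi u) ** phi v1) (psi n v2)) (dgc_comul v)) (dgc_comul x)).
  rewrite tensor_liftN !tensor_liftD; apply: eq_tensor_lift => u v.
  rewrite inner_d_cons outer_d_cons -IH.
  by rewrite [lcons _ (_ + outer_d _)](linear_funD tmul_r) !addrA.
rewrite comul_coassoc => [|v w|u w|u v].
- rewrite tensor_liftN tensor_liftD; apply: eq_tensor_lift => u v.
  rewrite -(linear_tensor_lift (fun u1 u2 => sg (phi u1) ** phi u2) _
    (letter_linear (psi n v))).
  have -> : tensor_lift (fun u1 u2 => sg (phi u1) ** phi u2) (dgc_comul u) =
      conv_square phi u.
    by apply: eq_tensor_lift => u1 u2; rewrite phi_sign.
  rewrite phi_sign twisting_d (linear_funD (letter_linear _)).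
  by rewrite addrAC addrK.
- apply: linear_comp (letter_linear _) _; apply: linear_comp mul_l _.
  exact: linear_comp (gsign_linear _) lphi.
- apply: linear_comp (letter_linear _) _; exact: linear_comp mul_r lphi.
- exact: linear_comp tmul_r (char_term_linear n).
Qed.

(** * Summation *)

Section LocallyFinite.
Hypothesis hfin : forall alpha : K,
  finite_set [set n : nat | char_term phi n alpha != 0]%classic.

Lemma char_term_bound x : exists N, forall n, (N <= n)%N -> psi n x = 0.
Proof.
have [r Hr] := (finite_seqP _).1 (hfin x).
exists (\max_(i <- r) i).+1 => n Hn; apply/eqP; apply: contraTT Hn => nz.
have : [set n : nat | char_term phi n x != 0]%classic n by [].
by rewrite Hr /= -leqNgt => nr; apply: (@leq_bigmax_seq _ _ xpredT id).
Qed.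

Lemma char_map_trunc N x : (forall n, (N <= n)%N -> psi n x = 0) ->
  char_map phi x = \sum_(n < N) psi n x.
Proof.
move=> H; rewrite /char_map (fsbigE (index_iota 0 N)) ?iota_uniq //.
  rewrite big_mkord; apply: eq_bigl => i; exact: in_setT.
by move=> n _; rewrite mem_index_iota -leqNgt; exact: H.
Qed.

Lemma char_map_linear : linear (char_map phi).
Proof.
move=> a x y; have [M HM] := char_term_bound x; have [N HN] := char_term_bound y.
have Hx n : (maxn M N <= n)%N -> psi n x = 0.
  by rewrite geq_max => /andP[/HM].
have Hy n : (maxn M N <= n)%N -> psi n y = 0.
  by rewrite geq_max => /andP[_ /HN].
rewrite (char_map_trunc Hx) (char_map_trunc Hy) (@char_map_trunc (maxn M N)).
  rewrite scaler_sumr -big_split; apply: eq_bigr => n _.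
  exact: char_term_linear.
by move=> n Hn; rewrite char_term_linear Hx // Hy // scaler0 addr0.
Qed.

Lemma char_map_deg n x : homog gK n x -> homog (bar_grading Omega) n (char_map phi x).
Proof.
move=> hx; have [N HN] := char_term_bound x; rewrite (char_map_trunc HN).
elim/big_ind: _ => [|y z|i _]; [exact: homog0|exact: homogD|exact: char_term_deg].
Qed.

Lemma char_map_counit x : bar_counit (char_map phi x) = dgc_counit x.
Proof.
have lc := @bar_counit_linear k Omega.
have cS n y : bar_counit (psi n.+1 y) = 0.
  apply: (char_term_eq (h := fun=> 0 : k^o)) => // [|s sn].
    exact: linear_zero.
  by rewrite bar_counitE sn.
have [N HN] := char_term_bound x.
rewrite (@char_map_trunc N.+1); last by move=> n /ltnW; exact: HN.
rewrite (linear_fun_sum _ _ _ lc) big_ord_recl big1 ?addr0 => [|i _].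
  by rewrite char_term0 (linear_funZ lc) bar_counitE; exact: mulr1.
exact: cS.
Qed.

(** The outer part lowers the word length by one, so the sum of the
[char_term_d] has to be regrouped: the boundary terms are the outer part of
psi_0, zero since there is nothing to multiply, and that of psi_N for a bound N. *)
Lemma char_map_d x : char_map phi (dgc_d x) = bar_d (char_map phi x).
Proof.
have [M HM] := char_term_bound x; have [N HN] := char_term_bound (dgc_d x).
have Hx n : (maxn M N <= n)%N -> psi n x = 0.
  by rewrite geq_max => /andP[/HM].
have Hd n : (maxn M N <= n)%N -> psi n (dgc_d x) = 0.
  by rewrite geq_max => /andP[_ /HN].
rewrite (char_map_trunc Hx) (char_map_trunc Hd).
rewrite (linear_fun_sum _ _ _ (@bar_d_linear k Omega)).
transitivity (\sum_(n < maxn M N) inner_d (psi n x) +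
              \sum_(n < maxn M N) outer_d (psi n.+1 x)).
  by rewrite -big_split; apply: eq_bigr => n _ /=; rewrite char_term_d.
have -> : \sum_(n < maxn M N) outer_d (psi n.+1 x) =
    \sum_(n < maxn M N) outer_d (psi n x).
  have := @big_ord_recl _ 0 +%R (maxn M N) (fun n => outer_d (psi n x)).
  rewrite /= big_ord_recr /= Hx // (linear_fun0 outer_d_linear) addr0 => ->.
  by rewrite (linear_funZ outer_d_linear) outer_d_nil scaler0 add0r.
rewrite -big_split; apply: eq_bigr => n _ /=.
by rewrite /outer_d addrC subrK.
Qed.

(** An element of K (x) K is a finite sum of pure tensors, so a common bound exists
although the vanishing hypothesis concerns single elements of K. *)
Lemma tensor_char_map_trunc (t : tensor K K) :
  exists N, forall M, (N <= M)%N -> tensor_map (char_map phi) (char_map phi) t =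
    \sum_(p < M) \sum_(q < M) tensor_map (psi p) (psi q) t.
Proof.
have lm := tensor_map_linear char_map_linear char_map_linear.
have lt p q := tensor_map_linear (char_term_linear p) (char_term_linear q).
elim/tensor_ind: t => [|a x y [Nx Hx] [Ny Hy]|u v].
- exists 0%N => M _; rewrite (linear_fun0 lm) big1 // => p _.
  by rewrite big1 // => q _; exact: linear_fun0.
- exists (maxn Nx Ny) => M; rewrite geq_max => /andP[/Hx Ex /Hy Ey].
  rewrite lm Ex Ey scaler_sumr -big_split; apply: eq_bigr => p _ /=.
  rewrite scaler_sumr -big_split; apply: eq_bigr => q _ /=.
  exact/esym/lt.
have [Nu Hu] := char_term_bound u; have [Nv Hv] := char_term_bound v.
exists (maxn Nu Nv) => M; rewrite geq_max => /andP[uM vM].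
rewrite tensor_mapE; try exact: char_map_linear.
rewrite (@char_map_trunc M u) => [|n /(leq_trans uM)/Hu //].
rewrite (@char_map_trunc M v) => [|n /(leq_trans vM)/Hv //].
rewrite (linear_fun_sum _ _ _ (pure_linearl _)); apply: eq_bigr => p _.
rewrite (linear_fun_sum _ _ _ (pure_linearr _)); apply: eq_bigr => q _.
by rewrite tensor_mapE; try exact: char_term_linear.
Qed.

Lemma char_map_comul x :
  deconcat (char_map phi x) = tensor_map (char_map phi) (char_map phi) (dgc_comul x).
Proof.
have [N1 H1] := char_term_bound x.
have [N2 H2] := tensor_char_map_trunc (dgc_comul x).
set M := maxn N1 N2.
have Hx n : (M <= n)%N -> psi n x = 0 by rewrite geq_max => /andP[/H1].
rewrite (H2 M (leq_maxr _ _)) (char_map_trunc Hx).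
rewrite (linear_fun_sum _ _ _ (@deconcat_linear k Omega)).
under eq_bigr => n _ do rewrite deconcat_char_term.
rewrite (@sum_triangle _ (fun p n => cut p (psi n x))) => [|p n Hn].
  apply: eq_bigr => p _; apply: eq_bigr => q _; exact/esym/char_term_cut.
by rewrite Hx // (linear_fun0 (cut_linear _)).
Qed.

Lemma char_map_hom : is_dgc_hom (D := bar Omega) (char_map phi).
Proof.
split; [exact: char_map_linear|exact: char_map_deg|exact: char_map_d| |].
  exact: char_map_comul.
exact: char_map_counit.
Qed.
End LocallyFinite.

End TwistingCochain.

Theorem lemma5 (k : fieldType) (hchar : [pchar k] =i pred0)
    (K : coaugDGCoalgebra k) (Omega : dgAlgebra k) (phi : K -> Omega)
    (hphi : twisting_cochain phi) :
  ((forall alpha : K,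
      finite_set [set n : nat | char_term phi n alpha != 0]%classic) ->
    is_dgc_hom (D := bar Omega) (char_map phi)) /\
  is_dga_hom (A := cobar K) (cochar_map phi).
Proof. by split; [exact: char_map_hom|exact: cochar_map_hom]. Qed.
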